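(* Let $\mathbb{N}_0$ be the set of nonnegative integers, and let $\Omega$ be the smallest collection of subsets of $\mathbb{N}_0$ satisfying (1) if $I \subseteq \mathbb{N}_0$ and $|I| \leq 2$, then $I \in \Omega$, and (2) if $I, J \in \Omega$, then $1+I+J := \{1+i+j : i \in I,\ j \in J\} \in \Omega$. For each $I \in \Omega$, there exists an integer $N(I)$ such that for every prime $p > N(I)$, there exists a finite $p$-group $P$ of exponent $p$ satisfying $$\widetilde{H}_i(\Delta\mathcal{A}_{\geq 2}(P)) \neq 0 \quad\text{if and only if}\quad i \in I.$$
   Context: For a finite $p$-group $P$, $\mathcal{A}_{\geq 2}(P)$ is the set of elementary abelian subgroups of $P$ having order at least $p^2$, partially ordered by inclusion. For a poset $\mathcal{P}$, the order complex $\Delta\mathcal{P}$ is the abstract simplicial complex whose $k$-dimensional faces are the chains $x_0 < \cdots < x_k$ in $\mathcal{P}$. $\widetilde{H}_i$ denotes reduced integral homology. $P$ has exponent $p$ if $g^p = 1$ for every $g \in P$. *)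

(* Defs.v *)
From HB Require Import structures.
From mathcomp Require Import all_boot all_order all_algebra.
From mathcomp Require Import all_fingroup all_solvable.
From mathcomp Require Import generic_quotient ring_quotient.
From mathcomp Require Import boolp classical_sets functions cardinality.

Set Implicit Arguments.
Unset Strict Implicit.
Unset Printing Implicit Defensive.

Import Order.TTheory GRing.Theory Num.Theory.
Local Open Scope ring_scope.

Section OrderComplex.
Context {d : Order.disp_t} {T : finPOrderType d}.

(* The empty chain belongs to the complex: it is the face of dimension -1,
   which makes the homology below reduced. *)
Definition order_complex (X : {set T}) : {set {set T}} :=
  [set s : {set T} | (s \subset X) && [forall x in s, forall y in s, (x >=< y)%O]].

Lemma order_complex_down (X s t : {set T}) :
  t \subset s -> s \in order_complex X -> t \in order_complex X.
Proof.
rewrite !inE => /fintype.subsetP ts /andP[/fintype.subsetP sX /forall_inP ch].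
apply/andP; split; first by apply/fintype.subsetP => x /ts /sX.
by apply/forall_inP => x /ts /ch /forall_inP ch'; apply/forall_inP => y /ts /ch'.
Qed.

End OrderComplex.

Section ReducedHomology.
Variable T : finType.

(* Integral chains, extended by zero to arbitrary vertex sets.  A set of
   vertices is oriented by the total order in which T is enumerated (unrelated
   to any partial order on T); another choice gives isomorphic homology. *)
Local Notation prechain := {ffun {set T} -> int}.

(* For s = {x_0, ..., x_k} listed in enumeration order, position s x_j = j. *)
Definition position (s : {set T}) (x : T) : nat :=
  #|[set y in s | (enum_rank y < enum_rank x)%N]|.

(* The linear extension of
     {x_0, ..., x_k} |-> \sum_j (-1)^j {x_0, ..., x_k} \ {x_j},
   read off coefficientwise: t is a facet of the sets x |: t with x \notin t.
   It preserves chains supported on K when K is closed under subsets, the empty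
   face included. *)
Definition boundary (c : prechain) : prechain :=
  [ffun t : {set T} =>
     \sum_(x | x \notin t) (-1) ^+ position (x |: t) x * c (x |: t)].

Lemma boundary_is_zmod_morphism : zmod_morphism boundary.
Proof.
move=> a b; apply/ffunP => t; rewrite !ffunE -sumrB.
by apply: eq_bigr => x _; rewrite !ffunE mulrBr.
Qed.
HB.instance Definition _ :=
  GRing.isZmodMorphism.Build prechain prechain boundary boundary_is_zmod_morphism.

Lemma positionU (t : {set T}) (x y : T) : y \notin t ->
  position (y |: t) x = ((enum_rank y < enum_rank x)%N + position t x)%N.
Proof.
move=> yt; rewrite /position; case yx: (enum_rank y < enum_rank x)%N.
  have -> : [set z in y |: t | (enum_rank z < enum_rank x)%N] =
            y |: [set z in t | (enum_rank z < enum_rank x)%N].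
    by apply/setP => z; rewrite !inE; case: eqP => // ->; rewrite yx.
  by rewrite cardsU1 !inE (negbTE yt).
have -> : [set z in y |: t | (enum_rank z < enum_rank x)%N] =
          [set z in t | (enum_rank z < enum_rank x)%N].
  by apply/setP => z; rewrite !inE; have [->|] := eqVneq z y; rewrite ?yx ?andbF.
by rewrite add0n.
Qed.

Lemma boundaryK (c : prechain) : boundary (boundary c) = 0.
Proof.
apply/ffunP => t; rewrite !ffunE.
pose F (x y : T) : int :=
  if (x != y) && (x \notin t) && (y \notin t) then
    (-1) ^+ position (x |: t) x * ((-1) ^+ position (y |: (x |: t)) y
      * c (y |: (x |: t))) else 0.
have S : \sum_x \sum_y F x y =
    \sum_(x | x \notin t) (-1) ^+ position (x |: t) x * boundary c (x |: t).
  rewrite [RHS]big_mkcond; apply: eq_bigr => x _; rewrite /F ffunE.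
  case: ifP => xt; last by rewrite big1 // => y _; rewrite andbF.
  rewrite mulr_sumr [RHS]big_mkcond; apply: eq_bigr => y _.
  by rewrite !inE negb_or eq_sym andbT.
rewrite -S; have A x y : F x y = - F y x.
  rewrite /F eq_sym; have [->|xy] /= := eqVneq y x; first by rewrite oppr0.
  rewrite andbC; case: (boolP (y \notin t)) => yt /=; last by rewrite oppr0.
  case: (boolP (x \notin t)) => xt /=; last by rewrite oppr0.
  have xyt : x \notin y |: t by rewrite !inE negb_or eq_sym xy.
  have yxt : y \notin x |: t by rewrite !inE negb_or xy.
  rewrite finset.setUCA !mulrA -mulNr; congr (_ * _).
  rewrite finset.setUCA (positionU _ yxt) finset.setUCA (positionU _ xyt).
  rewrite !(positionU _ xt) !(positionU _ yt) !ltnn !add0n.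
  have : enum_rank x != enum_rank y by rewrite (inj_eq enum_rank_inj) eq_sym.
  rewrite -val_eqE /=; case: ltngtP => //= _ _;
    by rewrite ?add0n ?add1n ?exprS ?mulN1r ?mulrN ?mulNr ?opprK mulrC.
have E : \sum_x \sum_y F x y = - \sum_x \sum_y F x y.
  rewrite {1}exchange_big /= -sumrN; apply: eq_bigr => x _.
  by rewrite -sumrN; apply: eq_bigr => y _.
by apply/eqP; rewrite -eqNr -E.
Qed.

Variables (K : {set {set T}}) (i : int).

(* Faces of dimension j have j + 1 vertices; for j < -1 there are none. *)
Definition chains (j : int) : {pred prechain} :=
  [pred c : prechain |
     [forall s, (c s != 0) ==> (s \in K) && (#|s|%:Z == j + 1)]].

Lemma chains_zmod_closed j : zmod_closed (chains j).
Proof.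
split=> [|a b]; first by apply/forallP => s; rewrite ffunE eqxx.
move=> /forallP Ka /forallP Kb; apply/forallP => s; apply/implyP.
have /implyP {}Ka := Ka s; have /implyP {}Kb := Kb s.
rewrite !ffunE; have [a0|/Ka //] := eqVneq (a s) 0.
by rewrite a0 add0r oppr_eq0 => /Kb.
Qed.
HB.instance Definition _ j :=
  GRing.isZmodClosed.Build prechain (chains j) (chains_zmod_closed j).

Definition cycles : {pred prechain} :=
  [pred c | (c \in chains i) && (boundary c == 0)].

Lemma cyclesE c : (c \in cycles) = (c \in chains i) && (boundary c == 0).
Proof. by []. Qed.

Lemma cycles_zmod_closed : zmod_closed cycles.
Proof.
split=> [|a b]; first by rewrite cyclesE rpred0 raddf0 eqxx.
rewrite !cyclesE => /andP[Ka /eqP a0] /andP[Kb /eqP b0].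
by rewrite rpredB //= raddfB /= a0 b0 subrr.
Qed.
HB.instance Definition _ :=
  GRing.isZmodClosed.Build prechain cycles cycles_zmod_closed.

Record cycle : Type := Cycle {cycle_val :> prechain; _ : cycle_val \in cycles}.
HB.instance Definition _ := [isSub for cycle_val].
HB.instance Definition _ := [Choice of cycle by <:].
HB.instance Definition _ := [SubChoice_isSubZmodule of cycle by <:].

Definition boundaries : {pred cycle} :=
  [pred z : cycle |
     `[< exists2 c : prechain, c \in chains (i + 1) & boundary c = val z >]].

Lemma boundariesP z : reflect
  (exists2 c : prechain, c \in chains (i + 1) & boundary c = val z)
  (z \in boundaries).
Proof. exact: asboolP. Qed.

Lemma boundaries_zmod_closed : zmod_closed boundaries.
Proof.
split=> [|a b].
  by apply/boundariesP; exists 0; rewrite ?rpred0 ?raddf0.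
move=> /boundariesP[c Kc ca] /boundariesP[e Ke eb]; apply/boundariesP.
by exists (c - e); rewrite ?rpredB // !raddfB /= ca eb.
Qed.
HB.instance Definition _ :=
  GRing.isZmodClosed.Build cycle boundaries boundaries_zmod_closed.

Definition reduced_homology : zmodType := {ideal_quot boundaries}.

Lemma reduced_homology_neq0P :
  (exists h : reduced_homology, h != 0) <->
  (exists z : cycle, z \notin boundaries).
Proof.
have pi0 (z : cycle) : (\pi_{ideal_quot boundaries} z == 0 :> {ideal_quot boundaries})%qT
    = (z \in boundaries).
  by rewrite -[in RHS](subr0 z) Quotient.idealrBE raddf0.
split=> [[h h0]|[z zB]]; last by exists (\pi_{ideal_quot boundaries} z)%qT; rewrite pi0.
by exists (generic_quotient.repr (h : {ideal_quot boundaries}));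
  rewrite -pi0 generic_quotient.reprK.
Qed.

End ReducedHomology.

(* Alias of {group gT} carrying the inclusion order. *)
Definition subgroup_poset (gT : finGroupType) : Type := {group gT}.
Section SubgroupPoset.
Variable gT : finGroupType.
HB.instance Definition _ := Finite.on (subgroup_poset gT).
Definition subgroup_le (G H : subgroup_poset gT) : bool :=
  ((G : {group gT}) \subset (H : {group gT})).
Lemma subgroup_le_refl : reflexive subgroup_le.
Proof. by move=> G; apply: subxx. Qed.
Lemma subgroup_le_anti : antisymmetric subgroup_le.
Proof. by move=> G H; rewrite /subgroup_le -finset.eqEsubset => /eqP/group_inj. Qed.
Lemma subgroup_le_trans : transitive subgroup_le.
Proof. by move=> G H L; apply: fintype.subset_trans. Qed.
HB.instance Definition _ :=
  Order.Le_isPOrder.Build (Order.Disp tt tt) (subgroup_poset gT)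
    subgroup_le_refl subgroup_le_anti subgroup_le_trans.
End SubgroupPoset.

Definition elementary_abelian_ge2 (gT : finGroupType) (p : nat)
    (P : {group gT}) : {set subgroup_poset gT} :=
  [set E : {group gT} in 'E_p(P)%g | (p ^ 2 <= #|E|)%N].

Local Open Scope classical_set_scope.
Local Open Scope card_scope.

Inductive Omega : set nat -> Prop :=
| Omega_card_le2 (I : set nat) : I #<= `I_2 -> Omega I
| Omega_add (I J : set nat) : Omega I -> Omega J ->
    Omega [set (1 + i + j)%N | i in I & j in J].

(* Main.v *)
(** Let Z be a central subgroup of order p of a group P of exponent p.  Then
E |-> EZ deforms A_{>=2}(P) onto the poset X(P) of abelian subgroups that
properly contain Z.  Choose e in P \ Z with [e, P] <= Z.  The members of X(P)
that meet C(e) in Z are the groups <x>Z with [e, x] <> 1; they are pairwise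
incomparable, and removing them leaves a conically contractible poset
(E >= E ∩ C(e) <= (E ∩ C(e))<e> >= Z<e>).  As X(P) above <x>Z is isomorphic to
X(C_P(e, x)), this gives, following Bouc and Thévenaz,
  H_i(X(P)) <> 0  iff  H_{i-1}(X(C_P(e, x))) <> 0 for some x with [e, x] <> 1.
By induction on the order, this recursion shows that the set of nonvanishing
degrees of a central product (amalgamating Z) is 1 + I + J, that an
extraspecial group of order p^(2k+1) contributes only the degree k - 1, and
that the degrees of K<u> are {0, m}, where K is extraspecial of order p^(2m+3)
and u acts on the symplectic space K/Z as a regular unipotent element: an x
outside K has C_P(e, x) = Z, and an x inside K has C_P(e, x) extraspecial of
order p^(2m+1).  Central products with the group of degree set {0} shift a
degree set by one, so every {a, b} occurs, and hence every member of Omega. *)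

Require Import Defs.
From HB Require Import structures.
From mathcomp Require Import all_boot all_order all_algebra.
From mathcomp Require Import all_fingroup all_solvable.
From mathcomp Require Import boolp classical_sets functions cardinality.
From mathcomp Require Import fintype finset.

Set Implicit Arguments.
Unset Strict Implicit.
Unset Printing Implicit Defensive.

Import Order.TTheory GRing.Theory Num.Theory.
Local Open Scope ring_scope.

(** * Simplicial chains *)

(** Only the vanishing of homology matters, so each homology group is replaced by the statement
    [acyclic] about chains, and long exact sequences by inserting or deleting one vertex at a time.

    The obstacle is the central product. For x = x1 x2 the centralizer of e and x in P1 P2 is not
    the product of centralizers in the factors: m1 m2 may centralize x although [x1, m1] and
    [x2, m2] are nontrivial elements of Z that cancel. The centralizer is instead a central product
    of C_P1(e, x1) with a twisted copy of the group of all m2 in P2 that commute with x2 modulo Z.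
    Hence two further facts are needed: the twist does not change the poset up to isomorphism, and
    passing to such a subgroup of P2 creates no new degree.

    The bound on p comes from the matrices that realize K<u>. They are unipotent of size 2m + 4, and
    x^p - 1 = (x - 1)^p vanishes once p >= 2m + 4. A Cayley transform yields u from a nilpotent
    element of the symplectic Lie algebra without factorials. *)

Section ChainOperators.
Variable T : finType.
Implicit Types (c : {ffun {set T} -> int}) (s t : {set T}) (v x y : T).

(* contract and extend are the annihilation and creation operators of an
   exterior algebra: they satisfy the canonical anticommutation relations, and
   the boundary is the sum of all contractions.  Hence extend v is a chain
   homotopy from the identity to zero wherever it preserves the complex. *)
Definition contract v c : {ffun {set T} -> int} :=
  [ffun t : {set T} => if v \in t then 0 else (-1) ^+ position (v |: t) v * c (v |: t)].

Definition extend v c : {ffun {set T} -> int} :=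
  [ffun s : {set T} => if v \in s then (-1) ^+ position s v * c (s :\ v) else 0].

Lemma boundary_contract c : boundary c = \sum_v contract v c.
Proof.
apply/ffunP=> t; rewrite ffunE sum_ffunE big_mkcond; apply: eq_bigr => v _.
by rewrite ffunE; case: (v \in t).
Qed.

Lemma extend_is_zmod_morphism v : zmod_morphism (extend v).
Proof.
by move=> a b; apply/ffunP => s; rewrite !ffunE; case: ifP; rewrite ?subr0 ?mulrBr.
Qed.
HB.instance Definition _ v :=
  GRing.isZmodMorphism.Build {ffun {set T} -> int} {ffun {set T} -> int}
    (extend v) (extend_is_zmod_morphism v).

Lemma contract_is_zmod_morphism v : zmod_morphism (contract v).
Proof.
by move=> a b; apply/ffunP => s; rewrite !ffunE; case: ifP; rewrite ?subr0 ?mulrBr.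
Qed.
HB.instance Definition _ v :=
  GRing.isZmodMorphism.Build {ffun {set T} -> int} {ffun {set T} -> int}
    (contract v) (contract_is_zmod_morphism v).

(** Exactly one of x and y precedes the other, so exactly one of the two positions changes when the
    other vertex is present. This is the source of all anticommutation signs. *)
Lemma sign_position_swap t x y : x != y -> x \notin t -> y \notin t ->
  (-1) ^+ position (x |: (y |: t)) x * (-1) ^+ position (y |: t) y =
  - ((-1) ^+ position (x |: (y |: t)) y * (-1) ^+ position (x |: t) x) :> int.
Proof.
move=> xy xt yt; have xyt : x \notin y |: t by rewrite !inE negb_or xy.
rewrite !(positionU _ xyt) !(positionU _ xt) !(positionU _ yt) !ltnn !add0n.
have : enum_rank x != enum_rank y by rewrite (inj_eq enum_rank_inj).
rewrite -val_eqE /= -!exprD; case: ltngtP => //= _ _;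
  by rewrite ?add0n ?add1n ?addSn ?addnS !exprS ?mulN1r ?opprK addnC.
Qed.

Lemma contractC v x c : contract v (contract x c) = - contract x (contract v c).
Proof.
apply/ffunP=> t; rewrite !ffunE !inE.
have [->|xv] /= := eqVneq x v; first by rewrite !mulr0 if_same oppr0.
case: (boolP (v \in t)) => vt /=; case: (boolP (x \in t)) => xt /=;
  rewrite ?mulr0 ?oppr0 //.
rewrite (setUCA [set v]) !mulrA -mulNr; congr (_ * _).
by rewrite [LHS]mulrC (sign_position_swap xv xt vt) [in RHS]mulrC.
Qed.

Lemma extendC v x c : x != v -> contract x (extend v c) = - extend v (contract x c).
Proof.
move=> xv; apply/ffunP=> t; rewrite !ffunE !inE xv /= eq_sym (negbTE xv) /=.
case: (boolP (v \in t)) => vt; case: (boolP (x \in t)) => xt /=;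
  rewrite ?mulr0 ?oppr0 //.
have -> : (x |: t) :\ v = x |: (t :\ v).
  by apply/setP=> y; rewrite !inE; have [->|] := eqVneq y v; rewrite //= ?(eq_sym v) ?(negbTE xv).
rewrite !mulrA -mulNr; congr (_ * _).
rewrite -{1 2 3}(setD1K vt).
have vr : v \notin t :\ v by rewrite !inE eqxx.
have xr : x \notin t :\ v by rewrite !inE negb_and xt orbT.
have := sign_position_swap xv xr vr; set r := t :\ v => H.
set a := (-1) ^+ position (x |: (v |: r)) x in H *.
set b := (-1) ^+ position (v |: r) v in H *.
set d := (-1) ^+ position (x |: (v |: r)) v in H *.
set e := (-1) ^+ position (x |: r) x in H *.
(* Signs are their own inverses, so the swap identity can be solved for [a]. *)
have bb : b * b = 1 by rewrite /b -expr2 sqrr_sign.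
have dd : d * d = 1 by rewrite /d -expr2 sqrr_sign.
have -> : a = - (d * e * b) by rewrite -mulNr -H -mulrA bb mulr1.
by rewrite mulNr [_ * d]mulrC !mulrA dd mul1r mulrC.
Qed.

Lemma contractK v c : contract v (extend v c) + extend v (contract v c) = c.
Proof.
apply/ffunP=> t; rewrite !ffunE !inE eqxx /=; case: (boolP (v \in t)) => vt.
  by rewrite add0r mulrA setD1K // -expr2 sqrr_sign mul1r.
by rewrite addr0 mulrA setU1K // -expr2 sqrr_sign mul1r.
Qed.

Lemma boundary_extend v c :
  boundary (extend v c) = c - extend v (boundary c).
Proof.
rewrite !boundary_contract raddf_sum (bigD1 v) //= [\sum_i extend _ _](bigD1 v) //=.
have -> : contract v (extend v c) = c - extend v (contract v c).
  by rewrite -{2}(contractK v c) addrK.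
rewrite opprD addrA; congr (_ + _).
by rewrite -sumrN; apply: eq_bigr => x xv; rewrite extendC.
Qed.

Lemma boundary_contractN v c : boundary (contract v c) = - contract v (boundary c).
Proof.
rewrite !boundary_contract raddf_sum -sumrN; apply: eq_bigr => x _.
exact: contractC.
Qed.

End ChainOperators.

(** * Acyclicity of order complexes and deletion of vertices *)

Section Acyclicity.
Context {d : Order.disp_t} {T : finPOrderType d}.
Implicit Types (c : {ffun {set T} -> int}) (X Y V s t : {set T}) (v x y : T) (i : int).

(** Vanishing of reduced homology in one degree, stated on chains so that no quotient has to be
    handled. *)
Definition acyclic X i := forall c, c \in chains (order_complex X) i ->
  boundary c = 0 ->
  exists2 e, e \in chains (order_complex X) (i + 1) & boundary e = c.

Lemma acyclicPn X i :
  (exists h : reduced_homology (order_complex X) i, h != 0) <-> ~ acyclic X i.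
Proof.
rewrite reduced_homology_neq0P; split=> [[z /negP zB] A|].
  apply: zB; apply/boundariesP; case: z => z /= zc.
  by move: (zc); rewrite cyclesE => /andP[cz /eqP bz]; apply: A.
apply: contra_notP => A c cz bz.
have zc : c \in cycles (order_complex X) i by rewrite cyclesE cz bz eqxx.
have /boundariesP[e] : Cycle zc \in boundaries (K := order_complex X) (i := i).
  by apply/negPn/negP => B; apply: A; exists (Cycle zc).
by move=> ce be; exists e.
Qed.

(** An order complex is a flag complex, so the link of a vertex is again an order complex and is
    determined by its set of vertices. *)
Definition link X v : {set T} := [set x in X | (x != v) && (x >=< v)%O].

Lemma order_complexP X s :
  reflect ({subset s <= X} /\ {in s &, forall x y, (x >=< y)%O}) (s \in order_complex X).
Proof.
rewrite inE; apply: (iffP andP) => -[sX ch]; split.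
- exact/fintype.subsetP.
- by move=> x y xs ys; have /forall_inP/(_ _ ys) := forall_inP ch _ xs.
- exact/fintype.subsetP.
- by apply/forall_inP => x xs; apply/forall_inP => y ys; apply: ch.
Qed.

Lemma chainsP (K : {set {set T}}) i c :
  reflect (forall s, c s != 0 -> s \in K /\ #|s|%:Z = i + 1) (c \in chains K i).
Proof.
apply: (iffP forallP) => H s; first by move/(implyP (H s))/andP => [? /eqP].
by apply/implyP => /H[-> ->]; rewrite eqxx.
Qed.

Lemma chains_subset X Y i c :
  X \subset Y -> c \in chains (order_complex X) i -> c \in chains (order_complex Y) i.
Proof.
move=> /subsetP XY /chainsP H; apply/chainsP => s /H[/order_complexP[sX ch] ->].
by split=> //; apply/order_complexP; split=> // x /sX/XY.
Qed.

Lemma extend_chains X v i c : v \in X ->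
  c \in chains (order_complex (link X v)) i ->
  extend v c \in chains (order_complex X) (i + 1).
Proof.
move=> vX /chainsP H; apply/chainsP => s; rewrite ffunE.
case: ifP => vs; last by rewrite eqxx.
rewrite mulf_eq0 negb_or => /andP[_ /H[/order_complexP[sL ch] card_s]].
have lk x : x \in s -> x != v -> (x \in X) && (x >=< v)%O.
  move=> xs xv; have := sL x; rewrite !inE xv xs => /(_ isT).
  by case/and3P=> -> _ ->.
split; last by rewrite -card_s (cardsD1 v s) vs add1n -addn1 PoszD.
apply/order_complexP; split=> [x xs|x y xs ys].
  by have [->|/(lk x xs)/andP[]] := eqVneq x v.
have [->|xv] := eqVneq x v.
  have [->|yv] := eqVneq y v; first exact: comparablexx.
  by rewrite comparable_sym; case/andP: (lk y ys yv).
have [->|yv] := eqVneq y v; first by case/andP: (lk x xs xv).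
by apply: ch; rewrite !inE ?xv ?yv.
Qed.

Lemma contract_chains X v i c :
  c \in chains (order_complex X) i ->
  contract v c \in chains (order_complex (link X v)) (i - 1).
Proof.
move=> /chainsP H; apply/chainsP => t; rewrite ffunE.
case: ifPn => vt; first by rewrite eqxx.
rewrite mulf_eq0 negb_or => /andP[_ /H[/order_complexP[sX ch] card_s]].
have U x : x \in t -> x \in v |: t by rewrite inE orbC => ->.
split; last first.
  by move: card_s; rewrite cardsU1 vt add1n -addn1 PoszD subrK => /addIr.
apply/order_complexP; split=> [x xt|x y xt yt]; last by apply: ch; apply: U.
rewrite inE sX ?U //=; apply/andP; split; first by apply: contraNneq vt => <-.
by apply: ch; [apply: U | apply: setU11].
Qed.

(** In the decomposition [contractK], this term is the part of c on the faces that avoid v, and the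
    other term is the part on the faces through v. *)
Lemma contract_extend_chains X v i c :
  c \in chains (order_complex X) i ->
  contract v (extend v c) \in chains (order_complex (X :\ v)) i.
Proof.
move=> /chainsP H; apply/chainsP => t; rewrite !ffunE.
case: ifPn => vt; first by rewrite eqxx.
rewrite setU11 mulrA -expr2 sqrr_sign mul1r setU1K //.
move=> /H[/order_complexP[sX ch] ->]; split=> //.
apply/order_complexP; split=> // x xt; rewrite !inE sX // andbT.
by apply: contraNneq vt => <-.
Qed.

Lemma contract_eq0 X v i c : v \notin X ->
  c \in chains (order_complex X) i -> contract v c = 0.
Proof.
move=> vX /chainsP H; apply/ffunP=> t; rewrite !ffunE.
case: ifPn => // vt; apply/eqP; rewrite mulf_eq0 orbC; apply/orP; left.
apply: contraNT vX => /H[/order_complexP[sX _] _].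
by apply: sX; rewrite !inE eqxx.
Qed.

Lemma link_subset X v : link X v \subset X :\ v.
Proof. by apply/subsetP=> x; rewrite !inE => /and3P[-> ->]. Qed.

Lemma cone_acyclic X v i : v \in X -> {in X, forall x, (x >=< v)%O} -> acyclic X i.
Proof.
move=> vX comp c cX bc.
exists (extend v c); last by rewrite boundary_extend bc raddf0 subr0.
(* The operator [extend v] ignores the faces of c through v; the remaining part lies on the link of
   v. *)
have -> : extend v c = extend v (contract v (extend v c)).
  apply/ffunP => s; rewrite !ffunE; case: (boolP (v \in s)) => vs //.
  by rewrite setD11 setD1K // vs [RHS]mulrA -expr2 sqrr_sign mul1r.
apply: extend_chains => //; apply: chains_subset (contract_extend_chains v cX).
by apply/subsetP => x; rewrite !inE => /andP[xv xX]; rewrite xX xv comp.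
Qed.

(** The part of c through v is a cone over a cycle of the link. If w fills that cycle, adding the
    boundary of [extend v w] replaces the cone by w and pushes c off v. *)
Lemma acyclic_add_vertex X v i : v \in X ->
  acyclic (link X v) (i - 1) -> acyclic (X :\ v) i -> acyclic X i.
Proof.
move=> vX lk A c cX bc.
have [|w wL bw] := lk _ (contract_chains v cX).
  by rewrite boundary_contractN bc raddf0 oppr0.
rewrite subrK in wL.
have [||e eX be] := A (c + boundary (extend v w)).
- rewrite boundary_extend bw -{1}(contractK v c) addrACA subrr addr0.
  rewrite rpredD ?contract_extend_chains //.
  exact: chains_subset (link_subset X v) wL.
- by rewrite raddfD /= bc boundaryK addr0.
exists (e - extend v w); last by rewrite raddfB /= be addrK.
rewrite rpredB ?(chains_subset (subD1set X v) eX) //.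
exact: extend_chains.
Qed.

(** Here the filling e is pushed off v: its trace on the link is a cycle because c avoids v, and a
    filling of the trace replaces the cone. *)
Lemma acyclic_remove_vertex X v i : v \in X ->
  acyclic (link X v) i -> acyclic X i -> acyclic (X :\ v) i.
Proof.
move=> vX lk A c cX bc.
have [|e eX be] := A c _ bc; first exact: chains_subset (subD1set X v) cX.
have vX' : v \notin X :\ v by rewrite !inE eqxx.
have [||w wL bw] := lk (contract v e).
- by have := contract_chains v eX; rewrite addrK.
- by rewrite boundary_contractN be (contract_eq0 vX' cX) oppr0.
exists (e + boundary (extend v w)); last by rewrite raddfD /= be boundaryK addr0.
rewrite boundary_extend bw -{1}(contractK v e) addrACA subrr addr0.
rewrite rpredD ?contract_extend_chains //.
exact: chains_subset (link_subset X v) wL.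
Qed.

Lemma acyclic_remove_vertexE X v : v \in X ->
  (forall i, acyclic (link X v) i) -> forall i, acyclic (X :\ v) i <-> acyclic X i.
Proof.
move=> vX lk i; split=> A; first exact: acyclic_add_vertex vX (lk _) A.
exact: acyclic_remove_vertex vX (lk _) A.
Qed.

(* The quotient of the order complex by that of X :\: V is a wedge of the
   suspended links of the elements of V. *)
Lemma acyclic_antichain X V : V \subset X ->
  {in V &, forall x y, (x >=< y)%O -> x = y} ->
  (forall i, acyclic (X :\: V) i) ->
  forall i, acyclic X i <-> {in V, forall v, acyclic (link X v) (i - 1)}.
Proof.
move=> VX anti A i.
have lkV v : v \in V -> link X v \subset X :\: V.
  move=> vV; apply/subsetP => x; rewrite !inE => /and3P[-> xv cxv].
  by rewrite andbT; apply: contra xv => xV; apply/eqP/anti.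
split=> [AX v vV z zL bz|lk].
  have [||e eX be] := A (i - 1) z.
  - exact: chains_subset (lkV v vV) zL.
  - by [].
  have vX := subsetP VX v vV.
  rewrite subrK in eX.
  (* The two fillings of z, one avoiding [V] and the cone from v, form a suspension of z. If w fills
     it, the part of w through v bounds z. *)
  have [||w wX bw] := AX (e - extend v z).
  - rewrite rpredB ?(chains_subset (subsetDl X V) eX) //.
    by have := extend_chains vX zL; rewrite subrK.
  - by rewrite raddfB /= boundary_extend bz raddf0 be subr0 subrr.
  exists (contract v w).
    by have := contract_chains v wX; rewrite addrK subrK.
  have vX' : v \notin X :\: V by rewrite !inE vV.
  have vL : v \notin link X v by rewrite !inE eqxx andbF.
  rewrite boundary_contractN bw raddfB /= (contract_eq0 vX' eX) sub0r opprK.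
  by rewrite -[RHS](contractK v z) (contract_eq0 vL zL) raddf0 addr0.
(* The elements of V are put back one at a time; since V is an antichain, each sees its full link in
   X no matter which others are present. *)
have H n (W : {set T}) : #|W| = n -> W \subset V -> acyclic ((X :\: V) :|: W) i.
  elim: n W => [|n IH] W; first by move/eqP; rewrite cards_eq0 => /eqP -> _; rewrite setU0.
  move=> cW WV; have [v vW] : exists v, v \in W by apply/set0Pn; rewrite -cards_eq0 cW.
  have vV := subsetP WV v vW.
  apply: (@acyclic_add_vertex _ v); first by rewrite inE vW orbT.
    suff -> : link (X :\: V :|: W) v = link X v by apply: lk.
    apply/setP => x; rewrite !inE; case: (boolP (x != v)) => xv; last by rewrite !andbF.
    case: (boolP (x >=< v)%O) => cxv; last by rewrite !andbF.
    have xV : x \notin V by apply: contra xv => xV; apply/eqP/anti.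
    by rewrite xV (contraNF (subsetP WV x) xV) orbF.
  have -> : (X :\: V :|: W) :\ v = X :\: V :|: (W :\ v).
    apply/setP => x; rewrite !inE; case: eqP => [->|] //=.
    by rewrite vV.
  apply: IH; last exact: fintype.subset_trans (subD1set _ _) WV.
  by move: cW; rewrite (cardsD1 v W) vW add1n => -[].
have := H _ V erefl (subxx V).
by rewrite setUC -{1}(setIidPr VX) setID.
Qed.

End Acyclicity.
(** * Closure operators and isomorphisms of posets *)

Section Retraction.
Context {d : Order.disp_t} {T : finPOrderType d}.
Implicit Types (X Y : {set T}) (x y : T).

(* The elements outside Y are deleted in increasing order of h; at that moment
   the link of x is a cone with apex f x. *)
Lemma acyclic_retract X Y (f : T -> T) (h : T -> nat) : Y \subset X ->
  {in X, forall x, f x \in Y} ->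
  {in X :\: Y, forall x, (x >=< f x)%O} ->
  {in X :\: Y & X, forall x y, (x >=< y)%O ->
     (y \in Y) || (h x <= h y)%N -> (y >=< f x)%O} ->
  forall i, acyclic Y i <-> acyclic X i.
Proof.
have [n] := ubnP #|X :\: Y|; elim: n X => // n IH X leXn YX fY cf cone i.
have [XY|/set0Pn[x0 x0XY]] := eqVneq (X :\: Y) set0.
  suff -> : X = Y by [].
  by apply/eqP; rewrite finset.eqEsubset YX -setD_eq0 XY eqxx.
case: (@arg_minnP _ x0 (fun y => y \in X :\: Y) h x0XY) => x xXY hmin.
have [xY xX] : x \notin Y /\ x \in X by move: xXY; rewrite inE => /andP[].
have lk j : acyclic (link X x) j.
  have fxx : f x != x by apply: contraNneq xY => <-; apply: fY.
  apply: (@cone_acyclic _ _ _ (f x)).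
    by rewrite !inE fxx (subsetP YX) ?fY //= comparable_sym cf.
  move=> y; rewrite !inE => /and3P[yX _ yx].
  apply: cone => //; first by rewrite comparable_sym.
  by case: (boolP (y \in Y)) => //= yY; apply: (hmin y); apply/setDP.
have sub : X :\ x \subset X by apply: subD1set.
have subD : {subset (X :\ x) :\: Y <= X :\: Y}.
  by move=> y; rewrite !inE => /and3P[-> _ ->].
apply: iff_trans (acyclic_remove_vertexE xX lk i).
apply: IH.
- apply: leq_trans (_ : #|X :\: Y| <= n)%N; last by rewrite -ltnS.
  apply: proper_card; apply/properP; split; first exact/subsetP.
  by exists x => //; rewrite !inE eqxx andbF.
- apply/subsetP => y yY; rewrite !inE (subsetP YX) // andbT.
  by apply: contraNneq xY => <-.
- by move=> y /(subsetP sub)/fY.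
- by move=> y /subD/cf.
- by move=> y z /subD yXY /(subsetP sub) zX; apply: cone.
Qed.

Lemma acyclic_retract_le X Y (f : T -> T) : Y \subset X ->
  {in X, forall x, f x \in Y} -> {in Y, forall y, f y = y} ->
  {in X &, {homo f : x y / (x <= y)%O}} -> {in X, forall x, (f x <= x)%O} ->
  forall i, acyclic Y i <-> acyclic X i.
Proof.
move=> YX fY fid mono le.
(* With this h the smaller elements are deleted first, so whatever remains strictly below x lies in
   Y, is fixed by f, and hence lies below f x. *)
apply: (@acyclic_retract X Y f (fun x => #|[set z | (z < x)%O]|)) => // [x|x y].
  by rewrite inE => /andP[_ xX]; rewrite ge_comparable ?le.
rewrite inE => /andP[_ xX] yX /orP[xy _|yx].
  by rewrite ge_comparable // (le_trans (le _ xX)).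
case/orP=> [yY|card_le]; first by rewrite le_comparable // -{1}(fid y yY) mono.
have [<-|] := eqVneq y x; first by rewrite ge_comparable ?le.
move=> neq; have ltyx : (y < x)%O by rewrite lt_neqAle neq yx.
suff : (#|[set z | (z < y)%O]| < #|[set z | (z < x)%O]|)%N by rewrite ltnNge card_le.
apply: proper_card; apply/properP; split.
  by apply/subsetP=> z; rewrite !inE => zy; apply: lt_trans ltyx.
by exists y; rewrite !inE ?ltxx.
Qed.

Lemma acyclic_retract_ge X Y (f : T -> T) : Y \subset X ->
  {in X, forall x, f x \in Y} -> {in Y, forall y, f y = y} ->
  {in X &, {homo f : x y / (x <= y)%O}} -> {in X, forall x, (x <= f x)%O} ->
  forall i, acyclic Y i <-> acyclic X i.
Proof.
move=> YX fY fid mono le.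
(* Dually, the larger elements are deleted first. *)
apply: (@acyclic_retract X Y f (fun x => #|[set z | (x < z)%O]|)) => // [x|x y].
  by rewrite inE => /andP[_ xX]; rewrite le_comparable ?le.
rewrite inE => /andP[_ xX] yX /orP[xy|yx _]; last first.
  by rewrite le_comparable // (le_trans yx) ?le.
case/orP=> [yY|card_le]; first by rewrite ge_comparable // -{1}(fid y yY) mono.
have [<-|] := eqVneq x y; first by rewrite le_comparable ?le.
move=> neq; have ltxy : (x < y)%O by rewrite lt_neqAle neq xy.
suff : (#|[set z | (y < z)%O]| < #|[set z | (x < z)%O]|)%N by rewrite ltnNge card_le.
apply: proper_card; apply/properP; split.
  by apply/subsetP=> z; rewrite !inE => yz; apply: lt_trans yz.
by exists y; rewrite !inE ?ltxx.
Qed.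

End Retraction.

(** * Invariance of acyclicity under isomorphism of posets *)

Section PosetIsomorphism.

Section Pullback.
Variables (T T' : finType) (f : T -> T').
Implicit Types (s t : {set T}) (x y : T).

(** Faces are oriented by the enumerations of the two types, which an isomorphism of posets need not
    respect; these signs repair the orientation. *)
Definition inversion_sign x y : int :=
  (-1) ^+ ((enum_rank x < enum_rank y)%N && (enum_rank (f y) < enum_rank (f x))%N).

(* The sign of the permutation that sorts f x_0, ..., f x_k, where
   s = {x_0, ..., x_k} is listed in enumeration order. *)
Definition image_sign s : int := \prod_(x in s) \prod_(y in s) inversion_sign x y.

Definition pullback (X : {set T}) (c : {ffun {set T'} -> int}) :
    {ffun {set T} -> int} :=
  [ffun s : {set T} => if s \subset X then image_sign s * c (f @: s) else 0].

Lemma image_signK s : image_sign s * image_sign s = 1.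
Proof.
rewrite -big_split big1 //= => x _; rewrite -big_split big1 //= => y _.
by rewrite -expr2 sqrr_sign.
Qed.

Lemma image_signU1 t x : x \notin t ->
  image_sign (x |: t) =
  \prod_(y in t) (inversion_sign x y * inversion_sign y x) * image_sign t.
Proof.
move=> xt; rewrite /image_sign big_setU1 //= big_setU1 //=.
rewrite {1}/inversion_sign ltnn /= mul1r big_split -mulrA /=; congr (_ * _).
by rewrite -big_split; apply: eq_bigr => y _; rewrite big_setU1.
Qed.

End Pullback.

Lemma sign_position (T : finType) (t : {set T}) x : x \notin t ->
  (-1) ^+ position (x |: t) x =
  \prod_(y in t) (-1) ^+ (enum_rank y < enum_rank x)%N :> int.
Proof.
move=> xt; rewrite positionU // ltnn add0n /position -prodr_const.
rewrite (eq_bigl (fun y => (y \in t) && (enum_rank y < enum_rank x)%N)).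
  by rewrite big_mkcondr; apply: eq_bigr => y _; case: ifP.
by move=> y; rewrite inE.
Qed.

Context {d d' : Order.disp_t} {T : finPOrderType d} {T' : finPOrderType d'}.

(** Holds factor by factor over y in t: the inversion signs of the pair x, y turn the sign that
    compares y with x into the one that compares f y with f x. *)
Lemma sign_position_image (f : T -> T') (X : {set T}) (t : {set T}) x :
  {in X &, injective f} -> x |: t \subset X -> x \notin t ->
  (-1) ^+ position (x |: t) x * image_sign f (x |: t) =
  image_sign f t * (-1) ^+ position (f x |: f @: t) (f x) :> int.
Proof.
move=> injf sX xt.
have xX : x \in X by apply: (subsetP sX); rewrite setU11.
have tX y : y \in t -> y \in X by move=> yt; apply: (subsetP sX); rewrite inE yt orbT.
have fxt : f x \notin f @: t.
  by apply/imsetP => -[y yt /(injf _ _ xX (tX y yt)) xy]; rewrite xy yt in xt.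
rewrite !sign_position // image_signU1 // mulrA mulrC; congr (_ * _).
rewrite big_imset /=; last by move=> y z /tX yX /tX; apply: injf.
rewrite -big_split; apply: eq_bigr => y yt /=.
have : enum_rank x != enum_rank y.
  by rewrite (inj_eq enum_rank_inj); apply: contraNneq xt => ->.
have : enum_rank (f x) != enum_rank (f y).
  rewrite (inj_eq enum_rank_inj); apply: contraNneq xt => /(injf _ _ xX (tX y yt)) ->.
  exact: yt.
rewrite -!val_eqE /= /inversion_sign.
case: (ltngtP (enum_rank x) (enum_rank y)) => //= _;
  by case: (ltngtP (enum_rank (f x)) (enum_rank (f y))).
Qed.

Section Transfer.
Variables (f : T -> T') (g : T' -> T) (X : {set T}) (Y : {set T'}).
Hypotheses (fXY : {in X, forall x, f x \in Y}) (gYX : {in Y, forall y, g y \in X}).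
Hypotheses (fK : {in X, cancel f g}) (gK : {in Y, cancel g f}).
Hypothesis fcomp : {in X &, forall x y, (f x >=< f y)%O = (x >=< y)%O}.

Lemma pullback_chains c i : c \in chains (order_complex Y) i ->
  pullback f X c \in chains (order_complex X) i.
Proof.
move=> /chainsP H; apply/chainsP => s; rewrite ffunE.
case: ifP => [/subsetP sX|]; last by rewrite eqxx.
rewrite mulf_eq0 negb_or => /andP[_ /H[/order_complexP[_ ch] <-]].
split; last first.
  by rewrite card_in_imset // => x y /sX xX /sX yX; apply: (can_in_inj fK).
apply/order_complexP; split=> // x y xs ys; rewrite -fcomp ?sX //.
by apply: ch; apply: imset_f.
Qed.

Lemma boundary_pullback c i : c \in chains (order_complex Y) i ->
  boundary (pullback f X c) = pullback f X (boundary c).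
Proof.
move=> /chainsP H; apply/ffunP => t; rewrite !ffunE.
case: ifP => [tX|tX]; last first.
  by rewrite big1 // => x _; rewrite ffunE subUset tX andbF mulr0.
pose F y := (-1) ^+ position (y |: f @: t) y * c (y |: f @: t).
have fYP y : y \in Y -> y = f (g y) by move/gK.
(* Since c is supported on Y, only vertices coming from X contribute to the boundary. *)
have -> : \sum_(y | y \notin f @: t) F y = \sum_(y in f @: (X :\: t)) F y.
  rewrite big_mkcond [RHS]big_mkcond; apply: eq_bigr => y _.
  have [yt|yt] /= := boolP (y \in f @: t).
    case: ifP => // /imsetP[x]; rewrite inE => /andP[xt xX] yx.
    case/imsetP: yt => z zt yz; rewrite yz in yx.
    have zx := can_in_inj fK (subsetP tX z zt) xX yx.
    by rewrite zx (negPf xt) in zt.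
  case: ifPn => // yXt; apply/eqP; rewrite /F mulf_eq0 orbC.
  apply/orP; left; apply: contraNT yXt => /H[/order_complexP[sY _] _].
  have yY : y \in Y by apply: sY; rewrite setU11.
  apply/imsetP; exists (g y); last exact: fYP.
  rewrite inE gYX // andbT; apply: contra yt => gyt.
  by rewrite (fYP y yY) imset_f.
rewrite big_imset /=; last first.
  by move=> x z; rewrite !inE => /andP[_ xX] /andP[_ zX]; apply: (can_in_inj fK).
rewrite mulr_sumr big_mkcond [RHS]big_mkcond; apply: eq_bigr => x _.
rewrite !inE; case: ifP => //= xt; rewrite ffunE subUset sub1set tX andbT.
case: ifP => xX; last by rewrite mulr0.
rewrite mulrA (sign_position_image (can_in_inj fK)) ?xt //.
  by rewrite imsetU1 -mulrA.
by rewrite subUset sub1set xX.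
Qed.

End Transfer.

Lemma pullbackK (f : T -> T') (g : T' -> T) (X : {set T}) (Y : {set T'}) c i :
  {in Y, forall y, g y \in X} -> {in Y, cancel g f} ->
  c \in chains (order_complex Y) i -> pullback g Y (pullback f X c) = c.
Proof.
move=> gYX gK /chainsP H; apply/ffunP=> s; rewrite !ffunE.
case: ifPn => [/subsetP sY|sY]; last first.
  apply/esym/eqP; apply: contraNT sY => /H[/order_complexP[sY _] _].
  exact/subsetP.
have -> : g @: s \subset X by apply/subsetP => _ /imsetP[y /sY/gYX yX ->].
have -> : f @: (g @: s) = s.
  rewrite -imset_comp (eq_in_imset (_ : {in s, f \o g =1 id})) ?imset_id //.
  by move=> y /sY/gK.
rewrite mulrA; suff -> : image_sign f (g @: s) = image_sign g s.
  by rewrite image_signK mul1r.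
have injg : {in s &, injective g}.
  by move=> y z /sY yY /sY zY; apply: (can_in_inj gK).
rewrite /image_sign big_imset //= [RHS]exchange_big; apply: eq_bigr => y ys.
rewrite big_imset //=; apply: eq_bigr => z zs.
by rewrite /inversion_sign !gK ?sY // andbC.
Qed.

End PosetIsomorphism.

Lemma acyclic_pullback (d d' : Order.disp_t) (T : finPOrderType d)
    (T' : finPOrderType d') (f : T -> T') (g : T' -> T) (X : {set T}) (Y : {set T'}) :
  {in X, forall x, f x \in Y} -> {in Y, forall y, g y \in X} ->
  {in X, cancel f g} -> {in Y, cancel g f} ->
  {in X &, forall x y, (f x >=< f y)%O = (x >=< y)%O} ->
  forall i, acyclic X i -> acyclic Y i.
Proof.
move=> fXY gYX fK gK fcomp i A c cY bc.
have gcomp : {in Y &, forall x y, (g x >=< g y)%O = (x >=< y)%O}.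
  by move=> x y xY yY; rewrite -fcomp ?gYX // !gK.
have [||e eX be] := A (pullback f X c).
- exact: (pullback_chains fK fcomp cY).
- rewrite (boundary_pullback gYX fK gK cY) bc.
  by apply/ffunP => s; rewrite !ffunE mulr0 if_same.
exists (pullback g Y e); first exact: (pullback_chains gK gcomp eX).
rewrite (boundary_pullback fXY gK fK eX) be.
exact: (pullbackK gYX gK cY).
Qed.

Lemma acyclic_iso (d d' : Order.disp_t) (T : finPOrderType d) (T' : finPOrderType d')
    (f : T -> T') (g : T' -> T) (X : {set T}) (Y : {set T'}) :
  {in X, forall x, f x \in Y} -> {in Y, forall y, g y \in X} ->
  {in X, cancel f g} -> {in Y, cancel g f} ->
  {in X &, {homo f : x y / (x <= y)%O}} -> {in Y &, {homo g : x y / (x <= y)%O}} ->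
  forall i, acyclic X i <-> acyclic Y i.
Proof.
move=> fXY gYX fK gK fm gm i.
have fc : {in X &, forall x y, (f x >=< f y)%O = (x >=< y)%O}.
  move=> x y xX yX; apply/orP/orP => -[]; do ?[by left; apply: fm | by right; apply: fm].
    by move=> /(gm _ _ (fXY x xX) (fXY y yX)); rewrite !fK //; left.
  by move=> /(gm _ _ (fXY y yX) (fXY x xX)); rewrite !fK //; right.
have gc : {in Y &, forall x y, (g x >=< g y)%O = (x >=< y)%O}.
  by move=> x y xY yY; rewrite -fc ?gYX // !gK.
by split; [apply: (acyclic_pullback fXY gYX) | apply: (acyclic_pullback gYX fXY)].
Qed.
Local Open Scope group_scope.

(** * The recursion over centralizers *)

(** The lower bound is a parameter because the link of a minimal member E is the same construction
    with E in place of Z. *)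
Definition abelian_above (gT : finGroupType) (P Z : {group gT}) :
    {set subgroup_poset gT} :=
  [set E : {group gT} | [&& Z \proper E, E \subset P & abelian E]].

(** Z may be smaller than the center, which makes the notion stable under passing to subgroups that
    contain Z. *)
Definition central_pair (gT : finGroupType) (p : nat) (P Z : {group gT}) :=
  [/\ prime p, #|Z| = p, Z \subset 'Z(P) & {in P, forall x, x ^+ p = 1}].

Section CentralCommutators.
Variables (gT : finGroupType) (p : nat) (P Z : {group gT}).
Hypothesis PZ : central_pair p P Z.
Implicit Types (e x y w z : gT) (E F H : {group gT}).

Let pr_p : prime p. Proof. by case: PZ. Qed.
Let oZ : #|Z| = p. Proof. by case: PZ. Qed.
Let exp_p x : x \in P -> x ^+ p = 1. Proof. by case: PZ => _ _ _; apply. Qed.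

Lemma central_pair_sub : Z \subset P.
Proof. by case: PZ => _ _ /subset_trans-> //; apply: center_sub. Qed.
Let sZP := central_pair_sub.

Lemma central_pairC z x : z \in Z -> x \in P -> commute z x.
Proof. by case: PZ => _ _ /subsetP sZ _ /sZ /centerP[_]; apply. Qed.
Let cZ := central_pairC.

Lemma central_pairS H : Z \subset H -> H \subset P -> central_pair p H Z.
Proof.
move=> ZH HP; split=> //; last by move=> x /(subsetP HP); apply: exp_p.
rewrite subsetI ZH; apply/centsP => z zZ x xH.
exact: cZ zZ (subsetP HP x xH).
Qed.

Lemma central_pair_pgroup : p.-group P.
Proof.
apply/pgroupP => q pr_q /(Cauchy pr_q)[x xP ox].
have : (#[x] %| p)%N by rewrite order_dvdn exp_p.
by rewrite ox dvdn_prime2 // => /eqP->; rewrite inE.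
Qed.

Lemma commg_mem e x : ([~ e, x] \in Z) = ([~ x, e] \in Z).
Proof. by rewrite -invg_comm groupV. Qed.

Lemma commgM_mem e x y : [~ e, x] \in Z -> y \in P ->
  [~ e, x * y] = [~ e, y] * [~ e, x].
Proof. by move=> exZ yP; rewrite commgMJ (conjgE [~ e, x]) (cZ exZ yP) mulKg. Qed.

Lemma order_central z : z \in Z -> z != 1 -> #[z] = p.
Proof.
by move=> zZ z1; apply: nt_prime_order => //; apply: exp_p; apply: (subsetP sZP).
Qed.

Lemma commgX_mem e x k : x \in P -> [~ e, x] \in Z -> [~ e, x ^+ k] = [~ e, x] ^+ k.
Proof. by move=> xP exZ; apply/commgX/commute_sym/cZ. Qed.

(** Since Z has prime order, [e, x] generates it, and a power of x cancels the commutator of e with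
    w. This replaces linear algebra in P/Z throughout. *)
Lemma commg_adjust e x w : x \in P -> w \in P ->
  [~ e, x] \in Z -> [~ e, x] != 1 -> [~ e, w] \in Z ->
  exists k, [~ e, x ^+ k * w] = 1.
Proof.
move=> xP wP exZ ex1 ewZ.
have gZ : <[ [~ e, x] ]> = Z.
  by apply/eqP; rewrite eqEcard cycle_subG exZ oZ -orderE (order_central exZ ex1) leqnn.
have : [~ e, w]^-1 \in <[ [~ e, x] ]> by rewrite gZ groupV.
case/cycleP=> k ewk; exists k.
by rewrite commgM_mem ?commgX_mem -?ewk ?mulgV // ewk groupX.
Qed.

Lemma expg_eq1_of_commg e x k : x \in P -> [~ e, x] \in Z -> [~ e, x] != 1 ->
  [~ e, x ^+ k] = 1 -> x ^+ k = 1.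
Proof.
move=> xP exZ ex1; rewrite commgX_mem // => /eqP; rewrite -order_dvdn.
rewrite order_central // => /dvdnP[m ->].
by rewrite mulnC expgM exp_p // expg1n.
Qed.

Lemma cent_join_cycle H x : H \subset P -> x \in P -> H \subset 'C[x] ->
  forall y, reflect (exists2 h, h \in H & exists k, y = h * x ^+ k) (y \in H <*> <[x]>).
Proof.
move=> HP xP cHx y; rewrite cent_joinEr; last by rewrite cycle_subG -sub_cent1.
apply: (iffP mulsgP) => [[h _ hH /cycleP[k ->] ->]|[h hH [k ->]]].
  by exists h => //; exists k.
by exists h (x ^+ k); rewrite ?mem_cycle.
Qed.

Lemma join_cycle_cap_cent e x H : x \in P -> [~ e, x] \in Z -> [~ e, x] != 1 ->
  H \subset P -> H \subset 'C[x] -> H \subset 'C[e] -> (H <*> <[x]>) :&: 'C[e] = H.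
Proof.
move=> xP exZ ex1 HP cHx cHe; apply/setP=> y; rewrite inE.
apply/andP/idP => [[/(cent_join_cycle HP xP cHx)[h hH [k ->]]]|yH]; last first.
  by rewrite (subsetP cHe) // mem_gen // inE yH.
move=> yC; have /cent1P xke : x ^+ k \in 'C[e] by rewrite -(groupMl _ (subsetP cHe h hH)).
have /eqP/(expg_eq1_of_commg xP exZ ex1) -> : [~ e, x ^+ k] == 1.
  by apply/commgP; apply: commute_sym.
by rewrite mulg1.
Qed.

End CentralCommutators.

(** * Subgroups that meet the centralizer of e in Z *)

Section CentralizerReduction.
Variable gT : finGroupType.
Implicit Types (P Z E F : {group gT}) (e x y : gT).

Lemma abelian_aboveP P Z E :
  reflect [/\ Z \proper E, E \subset P & abelian E]
    ((E : subgroup_poset gT) \in abelian_above P Z).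
Proof. by rewrite inE; apply: and3P. Qed.

Lemma abelian_above_refl Z : abelian_above Z Z = set0.
Proof.
apply/setP=> E; rewrite !inE; apply/negP=> /and3P[ZE EZ _].
by move: ZE; rewrite properE EZ andbF.
Qed.

Definition cent_pair P e x : {group gT} := (P :&: 'C[e] :&: 'C[x])%G.

Lemma cent_pairP P e x y :
  reflect [/\ y \in P, commute y e & commute y x] (y \in cent_pair P e x).
Proof.
rewrite !in_setI -andbA; apply: (iffP and3P) => [[yP /cent1P ye /cent1P yx]|[yP ye yx]] //.
by split=> //; apply/cent1P.
Qed.

Lemma abelian_join_cycle E x : abelian E -> E \subset 'C[x] -> abelian (E <*> <[x]>).
Proof.
by move=> cEE cEx; rewrite abelianY cEE cycle_abelian cycle_subG -sub_cent1.
Qed.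

Section Reduction.
Variables (p : nat) (P Z : {group gT}) (e : gT).
Hypothesis PZ : central_pair p P Z.
Hypothesis eC : {in P, forall x, [~ e, x] \in Z}.

Let sZP := central_pair_sub PZ.
Let cZ x : x \in P -> Z \subset 'C[x].
Proof. by move=> xP; apply/subsetP => z zZ; apply/cent1P/(central_pairC PZ). Qed.

Let join_sub E x : E \subset P -> x \in P -> E <*> <[x]> \subset P.
Proof. by move=> EP xP; rewrite join_subG EP cycle_subG. Qed.

Lemma notin_center_of_commg x : e \in P -> [~ e, x] != 1 -> x \notin Z.
Proof.
move=> eP; apply: contraNN => xZ; apply/commgP/commute_sym.
exact: (central_pairC PZ).
Qed.

(** A power of x moves any element of E into [E :&: 'C[e]], which is Z. So any single element
    outside Z determines E. *)
Lemma meets_center_eq E x : E \subset P -> Z \subset E -> E :&: 'C[e] = Z ->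
  x \in E -> x \notin Z -> [~ e, x] != 1 /\ E = (Z <*> <[x]>)%G.
Proof.
move=> EP ZE EeZ xE xZ.
have ex1 : [~ e, x] != 1.
  apply: contra xZ => /commgP ex; rewrite -EeZ inE xE.
  by apply/cent1P/commute_sym.
split=> //; apply/group_inj/eqP; rewrite eqEsubset /=; apply/andP; split; last first.
  by rewrite join_subG ZE cycle_subG.
apply/subsetP => w wE.
have [xP wP] := (subsetP EP x xE, subsetP EP w wE).
have [k ek] := commg_adjust PZ xP wP (eC xP) ex1 (eC wP).
have kZ : x ^+ k * w \in Z.
  rewrite -EeZ inE groupM ?groupX //=; apply/cent1P/commute_sym/commgP.
  by rewrite ek eqxx.
rewrite -(mulKg (x ^+ k) w) groupM //.
  by rewrite groupV mem_gen // inE mem_cycle orbT.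
by rewrite mem_gen // inE kZ.
Qed.

(** The isomorphism intersects F with C(e), and its inverse adjoins x. An abelian F above E contains
    x, so it centralizes x and is generated by x and its intersection with C(e). *)
Lemma meets_center_link E x i : E \subset P -> Z \subset E -> E :&: 'C[e] = Z ->
  x \in E -> x \notin Z ->
  acyclic (abelian_above P E) i <-> acyclic (abelian_above (cent_pair P e x) Z) i.
Proof.
move=> EP ZE EeZ xE xZ.
have [ex1 defE] := meets_center_eq EP ZE EeZ xE xZ.
have xP := subsetP EP x xE.
have cPx (F : {group gT}) : F \subset cent_pair P e x ->
    [/\ F \subset P, F \subset 'C[x] & F \subset 'C[e]].
  by rewrite !subsetI -andbA => /and3P[].
pose f (F : subgroup_poset gT) : subgroup_poset gT := (F :&: 'C[e])%G.
pose g (F : subgroup_poset gT) : subgroup_poset gT := (F <*> <[x]>)%G.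
have gK : {in abelian_above (cent_pair P e x) Z, cancel g f}.
  move=> F /abelian_aboveP[_ /cPx[FP Fx Fe] _]; apply: group_inj.
  exact: (join_cycle_cap_cent PZ xP (eC xP) ex1 FP Fx Fe).
have fK : {in abelian_above P E, cancel f g}.
  move=> F /abelian_aboveP[EF FP cFF]; apply/group_inj/eqP.
  have xF := subsetP (proper_sub EF) x xE.
  rewrite eqEsubset /=; apply/andP; split; first by rewrite join_subG subsetIl cycle_subG.
  apply/subsetP => w wF; have wP := subsetP FP w wF.
  have [k ek] := commg_adjust PZ xP wP (eC xP) ex1 (eC wP).
  rewrite -(mulKg (x ^+ k) w) groupM //.
    by rewrite groupV mem_gen // inE mem_cycle orbT.
  rewrite mem_gen // inE; apply/orP; left; rewrite inE groupM ?groupX //=.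
  by apply/cent1P/commute_sym/commgP; rewrite ek eqxx.
apply: (@acyclic_iso _ _ _ _ f g) => //.
- move=> F FX; move/abelian_aboveP: (FX) => [EF FP cFF].
  have xF := subsetP (proper_sub EF) x xE.
  have ZF : Z \subset F :&: 'C[e] by rewrite -EeZ setSI ?(proper_sub EF).
  apply/abelian_aboveP; split; last exact: abelianS (subsetIl _ _) cFF.
    rewrite properEneq ZF andbT; apply: contraTneq EF => ZFe.
    by rewrite -(fK F FX) defE properE /g /f /= ZFe subxx andbF.
  rewrite !subsetI subsetIr (fintype.subset_trans (subsetIl _ _) FP) /=.
  apply: fintype.subset_trans (subsetIl _ _) _.
  by rewrite sub_cent1 (subsetP cFF).
- move=> F /abelian_aboveP[ZF /cPx[FP Fx Fe] cFF].
  apply/abelian_aboveP; split; [|exact: join_sub|exact: abelian_join_cycle].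
  rewrite defE /g /= properEneq; apply/andP; split; last first.
    by rewrite join_subG joing_subr (fintype.subset_trans (proper_sub ZF)) ?joing_subl.
  apply: contraTneq ZF => ZxFx.
  rewrite -(join_cycle_cap_cent PZ xP (eC xP) ex1 FP Fx Fe) -ZxFx.
  have ZCe : Z \subset 'C[e] by rewrite -EeZ subsetIr.
  by rewrite (join_cycle_cap_cent PZ xP (eC xP) ex1) ?properxx //; apply: cZ.
- by move=> F G _ _ FG; apply: setSI.
- by move=> F G _ _ FG; apply: genS; apply: setSU.
Qed.

(* Contracts E to E :&: 'C[e], and then (E :&: 'C[e]) <*> <[e]> to Z <*> <[e]>. *)
Lemma acyclic_avoid_center i : e \in P -> e \notin Z ->
  acyclic [set E in abelian_above P Z | (E : {group gT}) :&: 'C[e] != Z] i.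
Proof.
move=> eP eZ.
pose Y1 := [set E in abelian_above P Z | (E : {group gT}) \subset 'C[e]].
pose Y2 := [set E in Y1 | e \in (E : {group gT})].
have inY1 (E : {group gT}) : reflect
    [/\ Z \proper E, E \subset P, abelian E & E \subset 'C[e]] ((E : subgroup_poset gT) \in Y1).
  rewrite inE; apply: (iffP andP) => [[/abelian_aboveP[]]|[? ? ? ?]] //.
  by split=> //; apply/abelian_aboveP.
apply: (proj1 (@acyclic_retract_le _ _ _ Y1 (fun E => (E :&: 'C[e])%G) _ _ _ _ _ i)).
- apply/subsetP => E /inY1[ZE EP cEE Ee]; rewrite inE; apply/andP; split.
    exact/abelian_aboveP.
  by rewrite (setIidPl Ee) eq_sym proper_neq.
- move=> E; rewrite inE => /andP[/abelian_aboveP[ZE EP cEE] neq].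
  apply/inY1; split; last exact: subsetIr.
  + by rewrite properEneq eq_sym neq subsetI (proper_sub ZE) cZ.
  + exact: fintype.subset_trans (subsetIl _ _) EP.
  + exact: abelianS (subsetIl _ _) cEE.
- by move=> E /inY1[_ _ _ Ee]; apply/group_inj/setIidPl.
- by move=> E F _ _ EF; apply: setSI.
- by move=> E _; apply: subsetIl.
have ZeY1 : (Z <*> <[e]>)%G \in Y1.
  apply/inY1; split.
  - rewrite properE joing_subl join_subG subxx cycle_subG eZ //.
  - exact: join_sub.
  - apply: abelian_join_cycle; last exact: cZ.
    by apply: cyclic_abelian; apply: prime_cyclic; case: PZ => ? ->.
  - by rewrite join_subG cZ //= cycle_subG; apply/cent1P.
apply: (proj1 (@acyclic_retract_ge _ _ _ Y2 (fun E => (E <*> <[e]>)%G) _ _ _ _ _ i)).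
- by apply/subsetP => E; rewrite inE => /andP[].
- move=> E /inY1[ZE EP cEE Ee]; rewrite inE; apply/andP; split; last first.
    by rewrite mem_gen // inE cycle_id orbT.
  apply/inY1; split; [|exact: join_sub|exact: abelian_join_cycle|].
    by apply: proper_sub_trans ZE (joing_subl _ _).
  by rewrite join_subG Ee cycle_subG; apply/cent1P.
- move=> E; rewrite inE => /andP[_ eE]; apply: group_inj => /=.
  by apply/joing_idPl; rewrite cycle_subG.
- by move=> E F _ _ EF; apply: genS; apply: setSU.
- by move=> E _; apply: joing_subl.
apply: (@cone_acyclic _ (subgroup_poset gT) Y2 (Z <*> <[e]>)%G).
  by rewrite inE ZeY1 mem_gen // inE cycle_id orbT.
move=> E; rewrite inE => /andP[/inY1[ZE _ _ _] eE]; apply: ge_comparable.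
by rewrite /Order.le /= /subgroup_le join_subG (proper_sub ZE) cycle_subG.
Qed.

Lemma acyclic_central_pair i : e \in P -> e \notin Z ->
  acyclic (abelian_above P Z) i <->
  {in P, forall x, [~ e, x] != 1 -> acyclic (abelian_above (cent_pair P e x) Z) (i - 1)}.
Proof.
move=> eP eZ; pose X := abelian_above P Z.
pose V := [set E in X | (E : {group gT}) :&: 'C[e] == Z].
have inV (E : {group gT}) : reflect
    [/\ Z \proper E, E \subset P, abelian E & E :&: 'C[e] = Z] ((E : subgroup_poset gT) \in V).
  rewrite inE; apply: (iffP andP) => [[/abelian_aboveP[? ? ?] /eqP]|[? ? ? ->]] //.
  by split=> //; apply/abelian_aboveP.
(* Comparable members share an element outside Z, which determines both. *)
have Vlt (E F : subgroup_poset gT) : E \in V -> F \in V -> (E <= F)%O -> E = F.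
  move=> /inV[/properP[ZE [x xE xZ]] EP _ EeZ] /inV[/proper_sub ZF FP _ FeZ] EF.
  have [_ ->] := meets_center_eq EP ZE EeZ xE xZ.
  by have [_ ->] := meets_center_eq FP ZF FeZ (subsetP EF x xE) xZ.
(* A member of X below E also meets C(e) in Z, hence equals E; the link therefore contains only what
   lies above E. *)
have linkV (E : subgroup_poset gT) : E \in V -> link X E = abelian_above P E.
  move=> EV; have /inV[ZE EP cEE EeZ] := EV.
  apply/setP=> F; rewrite inE; apply/andP/abelian_aboveP => [[/abelian_aboveP[ZF FP cFF]]|].
    case/andP=> FE /orP[leFE|leEF]; last first.
      split=> //; rewrite properE; apply/andP; split=> //; apply: contra FE => sFE.
      by apply/eqP/group_inj/eqP; rewrite eqEsubset sFE.
    case/negP: FE; apply/eqP/Vlt => //; apply/inV; split=> //.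
    apply/eqP; rewrite eqEsubset subsetI (proper_sub ZF) cZ // !andbT -EeZ.
    exact: setSI leFE.
  move=> [EF FP cFF]; split; first by apply/abelian_aboveP; split=> //; apply: proper_trans EF.
  have leEF : (E <= F)%O by apply: proper_sub EF.
  rewrite (ge_comparable leEF) andbT.
  by apply: contraTneq EF => ->; rewrite properxx.
have VX : V \subset X by apply/subsetP=> E; rewrite inE => /andP[].
have := @acyclic_antichain _ _ X V VX _ _ i; move=> ->.
- split=> [lk x xP ex1|A E EV].
    have xZ := notin_center_of_commg eP ex1.
    have cap : (Z <*> <[x]>)%G :&: 'C[e] = Z.
      by apply: (join_cycle_cap_cent PZ) => //; [apply: eC|apply: cZ|apply: cZ].
    have sub : (Z <*> <[x]>)%G \subset P by apply: join_sub.
    have xE : x \in (Z <*> <[x]>)%G by rewrite mem_gen // inE cycle_id orbT.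
    apply/(meets_center_link (i - 1) sub (joing_subl _ _) cap xE xZ).
    have ZxV : (Z <*> <[x]>)%G \in V.
      apply/inV; split=> //; last first.
        apply: abelian_join_cycle; last exact: cZ.
        by apply: cyclic_abelian; apply: prime_cyclic; case: PZ => ? ->.
      by rewrite properE joing_subl join_subG subxx cycle_subG xZ.
    by rewrite -linkV //; apply: lk.
  rewrite linkV //; have /inV[/properP[ZE [x xE xZ]] EP cEE EeZ] := EV.
  apply/(meets_center_link (i - 1) EP ZE EeZ xE xZ); apply: A.
    exact: (subsetP EP).
  by case: (meets_center_eq EP ZE EeZ xE xZ).
- move=> E F EV FV /orP[EF|FE]; first exact: Vlt.
  by apply/esym/Vlt.
- move=> j; suff -> : X :\: V = [set E in X | (E : {group gT}) :&: 'C[e] != Z].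
    exact: acyclic_avoid_center.
  by apply/setP => E; rewrite [LHS]inE [E \in V]inE [RHS]inE negb_and andb_orl andNb andbC.
Qed.

End Reduction.
End CentralizerReduction.

(** * Central products *)

Definition nontrivial_homology (gT : finGroupType) (P Z : {group gT}) (i : int) :=
  ~ acyclic (abelian_above P Z) i.

(** The complex has the empty face as its only face. This is where the recursions end. *)
Lemma nontrivial_homology_refl (gT : finGroupType) (Z : {group gT}) i :
  nontrivial_homology Z Z i <-> i = -1.
Proof.
rewrite /nontrivial_homology abelian_above_refl; split=> [|->].
  apply: contra_notP => i1 c c0 _; exists 0; first exact: rpred0.
  rewrite raddf0; apply/ffunP => s; rewrite ffunE; apply/esym/eqP.
  apply/negPn/negP => /(chainsP _ _ _ c0)[/order_complexP[s0 _] card_s].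
  case: i1; have : s = set0 by apply/setP => E; rewrite [RHS]inE; apply/negP => /s0; rewrite inE.
  by move=> s0'; move: card_s; rewrite s0' cards0 => /esym/eqP; rewrite addr_eq0 => /eqP.
pose c : {ffun {set subgroup_poset gT} -> int} := [ffun s => (s == set0)%:R].
move=> /(_ c)[||e e0 be].
- apply/chainsP => s; rewrite ffunE; have [->|_] := eqVneq s set0; last by rewrite eqxx.
  rewrite cards0; split=> //; apply/order_complexP; split=> x; rewrite !inE //.
- apply/ffunP => t; rewrite !ffunE big1 // => x _; rewrite ffunE.
  have [/setP/(_ x)|_] := eqVneq (x |: t) set0; last by rewrite mulr0.
  by rewrite setU11 inE.
have e_eq0 : e = 0.
  apply/ffunP => s; rewrite [RHS]ffunE; apply/eqP/negPn/negP.
  move=> /(chainsP _ _ _ e0)[/order_complexP[s0 _] card_s].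
  have s0' : s = set0 by apply/setP => E; rewrite [RHS]inE; apply/negP => /s0; rewrite inE.
  by move: card_s; rewrite s0' cards0.
by move: be; rewrite e_eq0 raddf0 => /ffunP/(_ set0); rewrite !ffunE eqxx.
Qed.

Section CentralPairs.
Variables (gT : finGroupType) (p : nat).
Implicit Types (P Q Z : {group gT}) (e x y : gT) (i j k : int).

Lemma nontrivial_homology_central_pair P Z e i :
  central_pair p P Z -> e \in P -> e \notin Z -> {in P, forall x, [~ e, x] \in Z} ->
  nontrivial_homology P Z i <->
  exists x, [/\ x \in P, [~ e, x] != 1
              & nontrivial_homology (cent_pair P e x) Z (i - 1)].
Proof.
move=> PZ eP eZ eC; rewrite /nontrivial_homology.
have [AW WA] := acyclic_central_pair PZ eC i eP eZ.
split=> [nA|[x [xP ex nAx]] A]; last by apply: nAx; apply: AW.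
apply: contra_notP nA => nE; apply: WA => x xP ex.
by apply: contrapT => nAx; apply: nE; exists x.
Qed.

(** P/Z is a nontrivial p-group, and e lifts a nontrivial element of its center. *)
Lemma exists_second_center P Z : central_pair p P Z -> Z \proper P ->
  exists e, [/\ e \in P, e \notin Z & {in P, forall x, [~ e, x] \in Z}].
Proof.
move=> PZ ZP; have [_ _ sZ _] := PZ.
have nZP : Z <| P := sub_center_normal sZ.
have ntQ : P / Z != 1 by rewrite -subG1 quotient_sub1 ?normal_norm // proper_subn.
have pQ : p.-group (P / Z) by apply/quotient_pgroup/(central_pair_pgroup PZ).
have : 'Z(P / Z) != 1.
  by apply: contra ntQ => /eqP/(trivg_center_pgroup pQ)->.
case/trivgPn=> _ /centerP[/morphimP[e eN eP ->] ce] e1; exists e; split=> //.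
  by apply: contra e1 => eZ; apply/eqP/coset_id.
move=> x xP; have xN := subsetP (normal_norm nZP) x xP.
apply: coset_idr; first by rewrite groupR.
rewrite morphR //; apply/eqP/commgP/ce.
exact: mem_quotient.
Qed.

(* Generated only for the sake of the group structure: the set is already a
   subgroup for central pairs. *)
Definition centraliser_mod P Z x : {group gT} :=
  <<[set m in P | [~ x, m] \in Z]>>%G.

Lemma centraliser_modP P Z x m : central_pair p P Z ->
  reflect (m \in P /\ [~ x, m] \in Z) (m \in centraliser_mod P Z x).
Proof.
move=> PZ; rewrite /= gen_set_id; first by rewrite inE; apply: andP.
apply/group_setP; split=> [|a b]; first by rewrite inE group1 commg1 group1.
rewrite !inE => /andP[aP xaZ] /andP[bP xbZ].
by rewrite groupM //= (commgM_mem PZ) // groupM.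
Qed.

Lemma central_pair_centraliser_mod P Z x : central_pair p P Z -> x \in P ->
  [/\ Z \subset centraliser_mod P Z x, centraliser_mod P Z x \subset P
    & central_pair p (centraliser_mod P Z x) Z].
Proof.
move=> PZ xP.
have sub : centraliser_mod P Z x \subset P.
  by apply/subsetP => m /(centraliser_modP _ _ PZ)[].
have sup : Z \subset centraliser_mod P Z x.
  apply/subsetP => z zZ; apply/centraliser_modP => //.
  split; first exact: (subsetP (central_pair_sub PZ)).
  have /commgP/eqP-> : commute x z by apply/commute_sym/(central_pairC PZ).
  exact: group1.
by split; last exact: (central_pairS PZ sup sub).
Qed.

Lemma cent_pair_sub P e x : cent_pair P e x \subset P.
Proof. by apply/subsetP => y /cent_pairP[]. Qed.

Lemma center_sub_cent_pair P Z e x : central_pair p P Z -> e \in P -> x \in P ->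
  Z \subset cent_pair P e x.
Proof.
move=> PZ eP xP; apply/subsetP => z zZ; apply/cent_pairP.
by split; [apply: (subsetP (central_pair_sub PZ))|apply: (central_pairC PZ)..].
Qed.

Lemma cent_pair_card P e x : e \in P -> [~ e, x] != 1 ->
  (#|cent_pair P e x| < #|P|)%N.
Proof.
move=> eP ex; apply: proper_card; rewrite properE cent_pair_sub /=.
apply: contra ex => /subsetP/(_ e eP)/cent_pairP[_ _ ex].
exact/commgP.
Qed.

(* For x of the form x1 * x2 in a central product, the factor P2 contributes
   centraliser_mod P2 Z x2 to the recursion; this lemma says that only the
   degrees of P2 itself occur. *)
Lemma nontrivial_homology_centraliser_mod P Z x i : central_pair p P Z -> x \in P ->
  nontrivial_homology (centraliser_mod P Z x) Z i -> nontrivial_homology P Z i.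
Proof.
have [n] := ubnP #|P|; elim: n P x i => // n IH P x i lePn PZ xP.
have [ZN NP NZ] := central_pair_centraliser_mod PZ xP.
have [ZP|] := boolP (Z \proper P); last first.
  rewrite properE (central_pair_sub PZ) /= negbK => PZs.
  suff -> : centraliser_mod P Z x = P by [].
  by apply/group_inj/eqP; rewrite eqEsubset NP (fintype.subset_trans PZs ZN).
have [e [eP eZ eC]] := exists_second_center PZ ZP.
(* Being central modulo Z, e lies in the subgroup, so the same e drives the recursion for both
   groups. *)
have eN : e \in centraliser_mod P Z x.
  by apply/centraliser_modP => //; split=> //; rewrite commg_mem eC.
have eCN : {in centraliser_mod P Z x, forall y, [~ e, y] \in Z}.
  by move=> y /(subsetP NP); apply: eC.
move=> /(nontrivial_homology_central_pair _ NZ eN eZ eCN)[y [yN ey nh]].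
have /(centraliser_modP _ _ PZ)[yP xyZ] := yN.
apply/(nontrivial_homology_central_pair _ PZ eP eZ eC); exists y; split=> //.
have ye : [~ y, e] != 1 by rewrite -invg_comm invg_eq1.
have yeZ : [~ y, e] \in Z by rewrite commg_mem eC.
have yxZ : [~ y, x] \in Z by rewrite commg_mem.
(* Powers of e and y correct x to an element x' of C(e, y) that has the same commutators as x with
   elements of C(e, y). The subgroup of the smaller group is then again of the form to which
   induction applies. *)
have [j yj] := commg_adjust PZ eP xP yeZ ye yxZ.
have ejP : e ^+ j * x \in P by rewrite groupM ?groupX.
have [k ek] := commg_adjust PZ yP ejP (eC y yP) ey (eC _ ejP).
set x' := y ^+ k * (e ^+ j * x) in ek.
have x'Q : x' \in cent_pair P e y.
  apply/cent_pairP; split; first by rewrite groupM ?groupX.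
    by apply/commute_sym/commgP; rewrite ek eqxx.
  apply/commute_sym/commuteM; first exact/commuteX.
  by apply/commgP; rewrite yj eqxx.
have QZ : central_pair p (cent_pair P e y) Z.
  exact: central_pairS PZ _ (center_sub_cent_pair PZ eP yP) (cent_pair_sub P e y).
apply: (IH _ x') => //; first by rewrite -ltnS (leq_trans _ lePn) // ltnS cent_pair_card.
suff <- : cent_pair (centraliser_mod P Z x) e y =
    centraliser_mod (cent_pair P e y) Z x' by [].
have x'E m : commute m e -> commute m y -> [~ x', m] = [~ x, m].
  move=> me my; rewrite /x' mulgA commMgJ.
  have /commgP/eqP-> : commute (y ^+ k * e ^+ j) m.
    by apply/commute_sym/commuteM; apply: commuteX.
  by rewrite conj1g mul1g.
apply/group_inj/setP => m; apply/cent_pairP/(centraliser_modP _ _ QZ).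
  move=> [/(centraliser_modP _ _ PZ)[mP xmZ] me my].
  by split; [apply/cent_pairP|rewrite x'E].
move=> [/cent_pairP[mP me my] x'm]; split=> //.
by apply/(centraliser_modP _ _ PZ); split=> //; rewrite -x'E.
Qed.

End CentralPairs.

Section CentralProduct.
Variables (gT : finGroupType) (p : nat) (Z : {group gT}).
Implicit Types (P Q R : {group gT}) (e x y : gT) (i j k : int).

Definition central_product P1 P2 :=
  [/\ central_pair p P1 Z, central_pair p P2 Z, P2 \subset 'C(P1) & P1 :&: P2 = Z].

Lemma mem_central_product P1 P2 x : central_product P1 P2 ->
  reflect (exists x1 x2, [/\ x1 \in P1, x2 \in P2 & x = x1 * x2]) (x \in P1 <*> P2).
Proof.
case=> _ _ cP12 _; rewrite cent_joinEr //.
apply: (iffP mulsgP) => [[x1 x2 ? ? ->]|[x1 [x2 [? ? ->]]]]; first by exists x1, x2.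
by exists x1 x2.
Qed.

Lemma central_product_pair P1 P2 : central_product P1 P2 ->
  central_pair p (P1 <*> P2)%G Z.
Proof.
move=> P12; have [PZ1 PZ2 cP12 _] := P12; have [pr_p oZ sZ1 exp1] := PZ1.
have [_ _ _ exp2] := PZ2.
split=> //; last first.
  move=> _ /(mem_central_product _ P12)[x1 [x2 [x1P x2P ->]]].
  have c12 : commute x1 x2 by apply: commute_sym; exact: (centsP cP12 _ x2P _ x1P).
  by rewrite (expgMn _ c12) exp1 // exp2 // mulg1.
rewrite subsetI (fintype.subset_trans (central_pair_sub PZ1)) ?joing_subl //=.
apply/centsP => z zZ _ /(mem_central_product _ P12)[x1 [x2 [x1P x2P ->]]].
by apply: commuteM; [apply: (central_pairC PZ1)|apply: (central_pairC PZ2)].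
Qed.

(* R :&: 'C[a] and R :&: 'C[b] are both complements of <[e]> in R, so both
   posets are isomorphic to the one above Z <*> <[e]>. *)
Lemma acyclic_swap_complement R e a b i :
  central_pair p R Z -> e \in R -> e \notin Z -> R \subset 'C[e] ->
  Z \subset 'C[a] -> Z \subset 'C[b] ->
  {in R, forall x, [~ a, x] \in Z} -> {in R, forall x, [~ b, x] \in Z} ->
  [~ a, e] != 1 -> [~ b, e] != 1 ->
  acyclic (abelian_above (R :&: 'C[a])%G Z) i ->
  acyclic (abelian_above (R :&: 'C[b])%G Z) i.
Proof.
move=> RZ eR eZ cRe cZa cZb aC bC ae be.
have ZR := central_pair_sub RZ.
have eE : e \in (Z <*> <[e]>)%G by rewrite mem_gen // inE cycle_id orbT.
have ER : (Z <*> <[e]>)%G \subset R by rewrite join_subG ZR cycle_subG.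
have cZe := fintype.subset_trans ZR cRe.
have red c : Z \subset 'C[c] -> {in R, forall x, [~ c, x] \in Z} -> [~ c, e] != 1 ->
    acyclic (abelian_above R (Z <*> <[e]>)%G) i <->
    acyclic (abelian_above (R :&: 'C[c])%G Z) i.
  move=> cZc cC ce.
  have cap : (Z <*> <[e]>)%G :&: 'C[c] = Z.
    by apply: (join_cycle_cap_cent RZ) => //; apply: cC.
  have := meets_center_link RZ cC i ER (joing_subl _ _) cap eE eZ.
  suff -> : cent_pair R c e = (R :&: 'C[c])%G by [].
  by apply/group_inj/setIidPl; apply: fintype.subset_trans (subsetIl _ _) cRe.
by move=> A; apply/red => //; apply/(red a).
Qed.

Section CentPair.
Variables (P1 P2 : {group gT}) (e x1 x2 : gT).
Hypothesis P12 : central_product P1 P2.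
Hypotheses (eP1 : e \in P1) (eZ : e \notin Z) (eC : {in P1, forall x, [~ e, x] \in Z}).
Hypotheses (x1P : x1 \in P1) (x2P : x2 \in P2) (ex1 : [~ e, x1] != 1).

Let PZ := central_product_pair P12.
(** [N2] collects the possible components in P2 of elements centralizing e and x1 x2. In [D] each of
    them is multiplied by a power of e that cancels its commutator with x1 x2. *)
Let N2 := centraliser_mod P2 Z x2.
Let R : {group gT} := (N2 <*> <[e]>)%G.
Let D : {group gT} := (R :&: 'C[x1 * x2])%G.
Let Q1 := cent_pair P1 e x1.

Let PZ1 : central_pair p P1 Z. Proof. by case: P12. Qed.
Let PZ2 : central_pair p P2 Z. Proof. by case: P12. Qed.
Let cap12 : P1 :&: P2 = Z. Proof. by case: P12. Qed.
Let P1P x : x \in P1 -> x \in (P1 <*> P2)%G. Proof. by move=> xP; rewrite mem_gen // inE xP. Qed.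
Let P2P x : x \in P2 -> x \in (P1 <*> P2)%G.
Proof. by move=> xP; rewrite mem_gen // inE xP orbT. Qed.
Let c12 a b : a \in P1 -> b \in P2 -> commute a b.
Proof.
by case: P12 => _ _ cP _ aP bP; apply: commute_sym; exact: (centsP cP _ bP _ aP).
Qed.
Let comm12 a b : a \in P1 -> b \in P2 -> [~ a, b] = 1.
Proof. by move=> aP bP; apply/eqP/commgP; apply: c12. Qed.
Let comm21 a b : a \in P2 -> b \in P1 -> [~ a, b] = 1.
Proof. by move=> aP bP; apply/eqP/commgP; apply: commute_sym; apply: c12. Qed.
Let xP : x1 * x2 \in (P1 <*> P2)%G. Proof. by apply: groupM; [apply: P1P | apply: P2P]. Qed.

Let N2P2 : N2 \subset P2. Proof. by case: (central_pair_centraliser_mod PZ2 x2P). Qed.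
Let ZN2 : Z \subset N2. Proof. by case: (central_pair_centraliser_mod PZ2 x2P). Qed.
Let N2P : N2 \subset (P1 <*> P2)%G. Proof. by apply/subsetP=> m /(subsetP N2P2)/P2P. Qed.
Let cN2e : N2 \subset 'C[e].
Proof. by apply/subsetP => m /(subsetP N2P2) mP; apply/cent1P; apply: commute_sym; apply: c12. Qed.
Let memR := cent_join_cycle N2P (P1P eP1) cN2e.

Let xe : [~ x1 * x2, e] != 1.
Proof. by rewrite commMgJ (comm21 x2P eP1) mulg1 conjg_eq1 -invg_comm invg_eq1. Qed.
Let xeZ : [~ x1 * x2, e] \in Z.
Proof.
rewrite commMgJ (comm21 x2P eP1) mulg1.
have x1eZ : [~ x1, e] \in Z by rewrite commg_mem eC.
by rewrite conjgE (central_pairC PZ2 x1eZ x2P) mulKg.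
Qed.

Let RP : R \subset (P1 <*> P2)%G.
Proof. by rewrite join_subG N2P cycle_subG P1P. Qed.

Let xR : {in R, forall y, [~ x1 * x2, y] \in Z}.
Proof.
suff /subsetP sub : R \subset centraliser_mod (P1 <*> P2)%G Z (x1 * x2).
  by move=> y /sub/(centraliser_modP _ _ PZ)[].
rewrite join_subG cycle_subG; apply/andP; split; last first.
  by apply/(centraliser_modP _ _ PZ); split=> //; apply: P1P.
apply/subsetP => m /(centraliser_modP _ _ PZ2)[mP mZ].
apply/(centraliser_modP _ _ PZ); split; first exact: P2P.
by rewrite commMgJ (comm12 x1P mP) conj1g mul1g.
Qed.

Let x1R : {in R, forall y, [~ x1, y] \in Z}.
Proof.
suff /subsetP sub : R \subset centraliser_mod (P1 <*> P2)%G Z x1.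
  by move=> y /sub/(centraliser_modP _ _ PZ)[].
rewrite join_subG cycle_subG; apply/andP; split; last first.
  apply/(centraliser_modP _ _ PZ); split; first exact: P1P.
  by rewrite commg_mem eC.
apply/subsetP => m /(centraliser_modP _ _ PZ2)[mP mZ].
apply/(centraliser_modP _ _ PZ); split; first exact: P2P.
by rewrite (comm12 x1P mP) group1.
Qed.

Let ZC x : x \in (P1 <*> P2)%G -> Z \subset 'C[x].
Proof. by move=> xP'; apply/subsetP => z zZ; apply/cent1P/(central_pairC PZ). Qed.

(** [N2] is the centralizer of x1 in [R], as [D] is that of x1 x2, and neither element commutes with
    e; so the exchange of complements applies. *)
Lemma acyclic_central_product_factor i :
  acyclic (abelian_above D Z) i <-> acyclic (abelian_above N2 Z) i.
Proof.
have RZ : central_pair p R Z.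
  exact: (central_pairS PZ (fintype.subset_trans ZN2 (joing_subl _ _)) RP).
have eR : e \in R by rewrite mem_gen // inE cycle_id orbT.
have cRe : R \subset 'C[e].
  by rewrite join_subG cN2e cycle_subG; apply/cent1P.
have x1e : [~ x1, e] != 1 by rewrite -invg_comm invg_eq1.
have -> : N2 = (R :&: 'C[x1])%G.
  apply/group_inj/esym/(join_cycle_cap_cent PZ) => //.
  - exact: P1P.
  - by rewrite commg_mem eC.
  - by apply/subsetP => m /(subsetP N2P2) mP; apply/cent1P; apply: commute_sym; apply: c12.
have [cx cx1] := (ZC xP, ZC (P1P x1P)).
by split; [apply: (acyclic_swap_complement RZ eR eZ cRe cx cx1 xR x1R xe x1e)
          |apply: (acyclic_swap_complement RZ eR eZ cRe cx1 cx x1R xR x1e xe)].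
Qed.

Lemma central_product_cent_pair : central_product Q1 D.
Proof.
have ZR : Z \subset R by apply: fintype.subset_trans ZN2 (joing_subl _ _).
have ZD : Z \subset D by rewrite subsetI ZR ZC.
have ZQ := center_sub_cent_pair PZ1 eP1 x1P.
have DP : D \subset (P1 <*> P2)%G by apply: fintype.subset_trans (subsetIl _ _) RP.
split.
- exact: (central_pairS PZ1 ZQ (cent_pair_sub _ _ _)).
- exact: (central_pairS PZ ZD DP).
- apply/centsP => y; rewrite inE => /andP[/memR[h hN [k ->]] _] q /cent_pairP[qP qe _].
  apply/commute_sym/commuteM; first exact: c12 (subsetP N2P2 h hN).
  exact: commuteX.
- apply/eqP; rewrite eqEsubset [X in _ && X]subsetI ZQ ZD !andbT.
  apply/subsetP => y /setIP[/cent_pairP[yP _ _] /setIP[yR yx]].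
  case/memR: (yR) => h hN [k defy].
  (* Both y and e lie in P1 and h lies in P2, so h is in Z. Then y is in Z<e> and commutes with x1
     x2, which leaves only Z. *)
  have hZ : h \in Z.
    rewrite -cap12 inE (subsetP N2P2) // andbT -(groupMr _ (_ : e ^+ k \in P1)) ?groupX //.
    by rewrite -defy.
  have cZe := fintype.subset_trans ZN2 cN2e.
  have ZP := central_pair_sub PZ.
  rewrite -(join_cycle_cap_cent PZ (P1P eP1) xeZ xe ZP cZe (ZC xP)) inE yx andbT.
  by apply/(cent_join_cycle ZP (P1P eP1) cZe); exists h => //; exists k.
Qed.

(** If m1 m2 commutes with x1 x2, then [x2, m2] is the inverse of [x1, m1], so it lies in both
    factors, that is in Z. Moving a suitable power of e from m1 to m2 makes both factors commute
    with x1 x2. *)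
Lemma cent_pair_central_product :
  cent_pair (P1 <*> P2)%G e (x1 * x2) = (Q1 <*> D)%G.
Proof.
apply/group_inj/eqP; rewrite eqEsubset; apply/andP; split; last first.
  rewrite join_subG; apply/andP; split; apply/subsetP => y.
    move=> /cent_pairP[yP ye yx]; apply/cent_pairP; split=> //; first exact: P1P.
    by apply: commuteM => //; apply: c12.
  case/setIP=> yR /cent1P yx; apply/cent_pairP; split=> //; first exact: (subsetP RP).
  case/memR: yR => h hN [k ->]; apply/commute_sym/commuteM; last exact: commuteX.
  exact: c12 eP1 (subsetP N2P2 h hN).
apply/subsetP => m /cent_pairP[/(mem_central_product _ P12)[m1 [m2 [m1P m2P ->]]] me mx].
have m2e : commute e m2 by apply: c12.
have m1e : m1 \in 'C[e].
  by rewrite -(groupMr _ (_ : m2 \in 'C[e])); apply/cent1P => //; apply: commute_sym.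
have x2m2 : [~ x2, m2] \in Z.
  have x12 : [~ x1, m1 * m2] = [~ x1, m1].
    rewrite commgMJ (comm12 x1P m2P) mul1g conjgE (c12 _ m2P) ?mulKg //.
    by rewrite groupR.
  have x22 : [~ x2, m1 * m2] = [~ x2, m2] by rewrite commgMJ (comm21 x2P m1P) conj1g mulg1.
  have := commMgJ x1 x2 (m1 * m2).
  have /eqP-> : [~ x1 * x2, m1 * m2] == 1 by apply/commgP/commute_sym.
  have x11 : [~ x1, m1] \in P1 by rewrite groupR.
  rewrite x12 x22 conjgE (c12 x11 x2P) mulKg => e1.
  have x2m2E : [~ x2, m2] = [~ x1, m1]^-1.
    by apply/eqP; rewrite eq_sym eq_invg_mul -e1.
  by rewrite -cap12 inE {1}x2m2E groupV x11 groupR.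
have m2N : m2 \in N2 by apply/(centraliser_modP _ _ PZ2).
have m2R : m2 \in R by rewrite mem_gen // inE m2N.
have [k ek] := commg_adjust PZ (P1P eP1) (P2P m2P) xeZ xe (xR m2R).
have eR : e ^+ k \in R by rewrite groupX // mem_gen // inE cycle_id orbT.
have dD : e ^+ k * m2 \in D.
  rewrite inE groupM //=; apply/cent1P/commute_sym/commgP.
  by rewrite ek eqxx.
have ekC : e ^+ k \in 'C[e] by rewrite groupX //; apply/cent1P.
have defm : m1 * m2 = m1 * e ^- k * (e ^+ k * m2) by rewrite -!mulgA mulKg.
rewrite defm groupM //; last by rewrite mem_gen // inE dD orbT.
rewrite mem_gen // inE; apply/orP; left; apply/cent_pairP; split.
- by rewrite groupM // groupV groupX.
- by apply/cent1P; rewrite groupM // groupV.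
have qx : m1 * e ^- k \in 'C[x1 * x2].
  have dx : e ^+ k * m2 \in 'C[x1 * x2] by case/setIP: dD.
  by rewrite -(groupMr _ dx) -defm; apply/cent1P.
have qP : m1 * e ^- k \in P1 by rewrite groupM // groupV groupX.
have xq : x1 * x2 \in 'C[m1 * e ^- k] by rewrite cent1C.
have x2q : x2 \in 'C[m1 * e ^- k] by apply/cent1P; apply: commute_sym; apply: c12.
by apply: commute_sym; apply/cent1P; rewrite -(groupMr _ x2q).
Qed.

End CentPair.

Lemma central_pair_proper P : central_pair p P Z -> P <> Z -> Z \proper P.
Proof.
move=> PZ neq; rewrite properEneq (central_pair_sub PZ) andbT eq_sym.
by apply/eqP => PZ'; apply: neq; apply: group_inj.
Qed.

(** Induction on P1 alone, for all P2, because [D] replaces P2 and need not lie in it. Forward, the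
    degrees of [D] are those of [N2], hence degrees of P2; backward, x2 = 1 makes [N2] equal to
    P2. *)
Lemma nontrivial_homology_central_product P1 P2 k : central_product P1 P2 ->
  nontrivial_homology (P1 <*> P2)%G Z k <->
  exists i j, [/\ nontrivial_homology P1 Z i, nontrivial_homology P2 Z j & k = i + j + 1].
Proof.
have [n] := ubnP #|P1|; elim: n P1 P2 k => // n IH P1 P2 k leP1n P12.
have [PZ1 PZ2 _ cap] := P12; have PZ := central_product_pair P12.
have [defP1|neqP1] := eqVneq P1 Z.
  have -> : (P1 <*> P2)%G = P2.
    by apply/group_inj/joing_idPr; rewrite defP1 (central_pair_sub PZ2).
  rewrite defP1; split=> [nh|[i [j [/nontrivial_homology_refl-> nh ->]]]].
    exists (-1)%R, k; split=> //; first exact/nontrivial_homology_refl.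
    by rewrite addrAC addNr add0r.
  by rewrite addrAC addNr add0r.
have [e [eP1 eZ eC1]] := exists_second_center PZ1 (central_pair_proper PZ1 (elimN eqP neqP1)).
have eP : e \in (P1 <*> P2)%G by rewrite mem_gen // inE eP1.
have e12 x1 x2 : x1 \in P1 -> x2 \in P2 -> [~ e, x1 * x2] = [~ e, x1].
  move=> x1P x2P; rewrite commgMJ conjgE (central_pairC PZ2 (eC1 _ x1P) x2P) mulKg.
  have /commgP/eqP-> : commute e x2; last by rewrite mul1g.
  by apply: commute_sym; case: P12 => _ _ cP _; exact: (centsP cP _ x2P _ eP1).
have eC : {in (P1 <*> P2)%G, forall x, [~ e, x] \in Z}.
  by move=> _ /(mem_central_product _ P12)[x1 [x2 [x1P x2P ->]]]; rewrite e12 ?eC1.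
have small x1 : [~ e, x1] != 1 -> (#|cent_pair P1 e x1| < n)%N.
  by move=> ex1; apply: leq_trans (cent_pair_card eP1 ex1) _; rewrite -ltnS.
rewrite (nontrivial_homology_central_pair _ PZ eP eZ eC).
split=> [[x [/(mem_central_product _ P12)[x1 [x2 [x1P x2P ->]]]]]|].
  rewrite e12 // => ex1.
  rewrite (cent_pair_central_product P12 eP1 eC1 x1P x2P ex1).
  have CP := central_product_cent_pair P12 eP1 eC1 x1P x2P ex1.
  move=> /(IH _ _ _ (small x1 ex1) CP)[i [j [nhi nhj def_k]]].
  exists (i + 1)%R, j; split.
  - apply/(nontrivial_homology_central_pair _ PZ1 eP1 eZ eC1).
    by exists x1; rewrite addrK.
  - apply: (nontrivial_homology_centraliser_mod PZ2 x2P) => A; apply: nhj.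
    by apply/(acyclic_central_product_factor P12 eP1 eZ eC1 x1P x2P ex1).
  - by rewrite (addrAC i) -def_k subrK.
case=> i [j [/(nontrivial_homology_central_pair _ PZ1 eP1 eZ eC1)[x1 [x1P ex1 nhi]] nhj ->]].
have x2P : 1 \in P2 by apply: group1.
exists (x1 * 1); split; first by apply/(mem_central_product _ P12); exists x1, 1.
  by rewrite e12.
rewrite (cent_pair_central_product P12 eP1 eC1 x1P x2P ex1).
apply/(IH _ _ _ (small x1 ex1) (central_product_cent_pair P12 eP1 eC1 x1P x2P ex1)).
exists (i - 1)%R, j; split=> //; last by rewrite addrK addrAC subrK.
move=> /(acyclic_central_product_factor P12 eP1 eZ eC1 x1P x2P ex1).
suff -> : centraliser_mod P2 Z 1 = P2 by [].
apply/group_inj/setP => m; apply/(centraliser_modP _ _ PZ2)/idP => [[]|mP] //.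
by rewrite comm1g group1.
Qed.

End CentralProduct.

(** * Extraspecial groups and their extensions of maximal class *)

Section ExtraspecialHomology.
Variables (gT : finGroupType) (p : nat) (Z : {group gT}).
Implicit Types (P Q K : {group gT}) (e x y : gT) (i : int).

(** The group <x>, of order p, is a complement of C_P(a) in P. *)
Lemma card_cent_commg P a x : central_pair p P Z -> {in P, forall y, [~ a, y] \in Z} ->
  x \in P -> [~ a, x] != 1 -> (#|P| = #|P :&: 'C[a]| * p)%N.
Proof.
move=> PZ aC xP ax.
have xp : x ^+ p = 1 by case: PZ => _ _ _; apply.
have pr_p : prime p by case: PZ.
have x1 : x != 1 by apply: contraNneq ax => ->; rewrite commg1.
have ox := nt_prime_order pr_p xp x1.
have defP : P :=: <[x]> * (P :&: 'C[a]).
  apply/eqP; rewrite eqEsubset mul_subG ?cycle_subG ?subsetIl // andbT.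
  apply/subsetP => y yP.
  have [k ak] := commg_adjust PZ xP yP (aC x xP) ax (aC y yP).
  rewrite -(mulKg (x ^+ k) y) mem_mulg ?groupV ?mem_cycle //.
  rewrite inE groupM ?groupX //=; apply/cent1P/commute_sym/commgP.
  by rewrite ak eqxx.
rewrite {1}defP TI_cardMg; first by rewrite -orderE ox mulnC.
apply/trivgP/subsetP => y /setIP[/cycleP[k ->] /setIP[_ /cent1P xa]].
rewrite inE; apply/eqP/(expg_eq1_of_commg PZ xP (aC x xP) ax).
by apply/eqP/commgP/commute_sym.
Qed.

(* P is extraspecial of order p ^ (2k + 1), or P = Z if k = 0. *)
Definition special_pair k P :=
  [/\ central_pair p P Z, {in P &, forall x y, [~ x, y] \in Z}, 'Z(P) \subset Z
    & #|P| = (p ^ k.*2.+1)%N].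

Lemma special_pair_noncentral k P e : special_pair k P -> e \in P -> e \notin Z ->
  exists2 x, x \in P & [~ e, x] != 1.
Proof.
case=> PZ _ /subsetP sZ _ eP eZ; apply: contrapT => H; case/negP: eZ.
apply: sZ; apply/centerP; split=> // x xP; apply/commgP/negPn/negP => ex.
by apply: H; exists x.
Qed.

(** In the symplectic space P/Z this is the orthogonal complement of the hyperbolic plane spanned by
    e and x. Every element of P is corrected into it by powers of e and x, so its center is central
    in P. *)
Lemma special_cent_pair k P e x : special_pair k.+1 P -> e \in P -> x \in P ->
  [~ e, x] != 1 -> special_pair k (cent_pair P e x).
Proof.
case=> PZ cP /subsetP sZ oP eP xP ex.
have sub := cent_pair_sub P e x.
have QZ := central_pairS PZ (center_sub_cent_pair PZ eP xP) sub.
have xe : [~ x, e] != 1 by rewrite -invg_comm invg_eq1.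
have eC : {in P, forall y, [~ e, y] \in Z} by move=> y; apply: cP.
have xC : {in P, forall y, [~ x, y] \in Z} by move=> y; apply: cP.
split=> //.
- by move=> y z /(subsetP sub) yP /(subsetP sub); apply: cP.
- apply/subsetP => z /centerP[zQ cz]; apply: sZ.
  have [zP ze zx] := cent_pairP _ _ _ _ zQ.
  apply/centerP; split=> // w wP.
  have [j ej] := commg_adjust PZ xP wP (eC x xP) ex (eC w wP).
  have jP : x ^+ j * w \in P by rewrite groupM ?groupX.
  have [k' xk] := commg_adjust PZ eP jP (xC e eP) xe (xC _ jP).
  have uQ : e ^+ k' * (x ^+ j * w) \in cent_pair P e x.
    apply/cent_pairP; split; first by rewrite groupM ?groupX.
      apply/commute_sym/commuteM; first exact/commuteX.
      by apply/commgP; rewrite ej eqxx.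
    by apply/commute_sym/commgP; rewrite xk eqxx.
  have -> : w = x ^- j * (e ^- k' * (e ^+ k' * (x ^+ j * w))) by rewrite !mulKg.
  apply: commuteM; first exact/commuteV/commuteX.
  by apply: commuteM; [apply/commuteV/commuteX|apply: cz].
have PeZ : central_pair p (P :&: 'C[e])%G Z.
  apply: (central_pairS PZ); last exact: subsetIl.
  rewrite subsetI (central_pair_sub PZ) /=; apply/subsetP => z zZ.
  by apply/cent1P/(central_pairC PZ).
have pr_p : prime p by case: PZ.
have ePe : e \in (P :&: 'C[e])%G by rewrite inE eP; apply/cent1P.
have := card_cent_commg PZ eC xP ex.
rewrite (card_cent_commg PeZ (_ : {in (P :&: 'C[e])%G, forall y, [~ x, y] \in Z}) ePe xe).
  rewrite oP doubleS !expnSr => /eqP.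
  by rewrite !eqn_pmul2r ?prime_gt0 // => /eqP ->.
by move=> y /setIP[yP _]; apply: xC.
Qed.

Lemma nontrivial_homology_special k P i : special_pair k P ->
  nontrivial_homology P Z i <-> i = k%:Z - 1.
Proof.
elim: k P i => [|k IH] P i SP; have [PZ cP sZ oP] := SP.
  have -> : P = Z.
    apply/esym/group_inj/eqP; rewrite eqEcard (central_pair_sub PZ) oP.
    by case: PZ => _ -> _ _; rewrite double0 expn1 leqnn.
  by rewrite sub0r; apply: nontrivial_homology_refl.
have pr_p : prime p by case: PZ.
have [e eP eZ] : exists2 e, e \in P & e \notin Z.
  apply/subsetPn/negP => /subset_leq_card; rewrite oP; case: PZ => _ -> _ _.
  have : (p ^ 1 < p ^ k.+1.*2.+1)%N by rewrite (ltn_exp2l _ _ (prime_gt1 pr_p)) ltnS double_gt0.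
  by rewrite expn1 ltnNge => /negP.
have eC : {in P, forall y, [~ e, y] \in Z} by move=> y; apply: cP.
rewrite (nontrivial_homology_central_pair _ PZ eP eZ eC); split.
  case=> x [xP ex /(IH _ _ (special_cent_pair SP eP xP ex))/addIr ->].
  by rewrite -addn1 PoszD addrK.
move=> ->; have [x xP ex] := special_pair_noncentral SP eP eZ.
exists x; split=> //; apply/(IH _ _ (special_cent_pair SP eP xP ex)).
by rewrite -addn1 PoszD addrK.
Qed.

End ExtraspecialHomology.

Section MaximalClassHomology.
Variables (gT : finGroupType) (p : nat) (P K Z : {group gT}) (e : gT) (m : nat).
Hypotheses (PZ : central_pair p P Z) (KP : K \proper P) (SK : special_pair p Z m.+1 K).
Hypothesis cyclicPK : forall x y, x \in P :\: K -> y \in P -> exists j, x ^+ j * y \in K.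
Hypotheses (eK : e \in K) (eZ : e \notin Z) (eC : {in P, forall x, [~ e, x] \in Z}).
(** An element outside K fixes only the line of e in K/Z, as a regular unipotent element does. *)
Hypothesis regular : forall x y, x \in P :\: K -> y \in K -> [~ y, x] \in Z ->
  y \in Z <*> <[e]>.

Let sKP := proper_sub KP.
Let eP : e \in P := subsetP sKP e eK.
Let ZP := central_pair_sub PZ.
Let cZe : Z \subset 'C[e].
Proof. by apply/subsetP => z zZ; apply/cent1P/(central_pairC PZ). Qed.

Let regularC x y : x \in P :\: K -> y \in K -> commute y x -> y \in Z <*> <[e]>.
Proof.
by move=> xPK yK /commgP/eqP yx; apply: (regular xPK) => //; rewrite yx group1.
Qed.

Let eqcZe : Z <*> <[e]> \subset 'C[e].
Proof. by rewrite join_subG cZe cycle_subG; apply/cent1P. Qed.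

(** An element outside K commuting with x would force x into Z<e>, hence to commute with e. *)
Lemma cent_pair_in x : x \in K -> [~ e, x] != 1 -> cent_pair P e x = cent_pair K e x.
Proof.
move=> xK ex; apply/group_inj/setP => y.
apply/cent_pairP/cent_pairP => -[yP ye yx]; split=> //; last exact: (subsetP sKP).
apply: contraR ex => yK; have yPK : y \in P :\: K by rewrite inE yK.
apply/commgP/commute_sym/cent1P/(subsetP eqcZe)/(regularC yPK xK).
exact: commute_sym.
Qed.

(** For y commuting with e and x, some x^j y lies in K and commutes with x, so it lies in Z<e>. Then
    x^j commutes with e, which gives x^j = 1; and an element of Z<e> commuting with x is in Z. *)
Lemma cent_pair_out x : x \in P :\: K -> [~ e, x] != 1 -> cent_pair P e x = Z.
Proof.
move=> xPK ex; have /setDP[xP _] := xPK.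
have ZCx : Z \subset 'C[x] by apply/subsetP => z zZ; apply/cent1P/(central_pairC PZ).
have xe : [~ x, e] != 1 by rewrite -invg_comm invg_eq1.
have xeZ : [~ x, e] \in Z by rewrite commg_mem eC.
apply/group_inj/eqP; rewrite eqEsubset (center_sub_cent_pair PZ) // andbT.
apply/subsetP => y /cent_pairP[yP ye yx].
have [j wK] := cyclicPK xPK yP.
have wx : commute (x ^+ j * y) x.
  by apply/commute_sym/commuteM; [apply: commuteX|apply: commute_sym].
have wE := regularC xPK wK wx.
have we : commute e (x ^+ j * y) by apply/commute_sym/cent1P/(subsetP eqcZe).
have xj : x ^+ j = 1.
  apply: (expg_eq1_of_commg PZ xP (eC xP) ex); apply/eqP/commgP.
  by rewrite -(mulgK y (x ^+ j)); apply: commuteM => //; apply/commuteV/commute_sym.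
rewrite xj mul1g in wE.
rewrite -(join_cycle_cap_cent PZ eP xeZ xe ZP cZe ZCx) inE wE.
exact/cent1P.
Qed.

Lemma nontrivial_homology_maximal_class i :
  nontrivial_homology P Z i <-> i = 0 \/ i = m%:Z.
Proof.
have [x0 x0K ex0] := special_pair_noncentral SK eK eZ.
have [_ [g gP gK]] := properP KP.
rewrite (nontrivial_homology_central_pair _ PZ eP eZ eC); split.
  case=> x [xP ex]; have [xK|xK] := boolP (x \in K).
    rewrite (cent_pair_in xK ex).
    move/(nontrivial_homology_special _ (special_cent_pair SK eK xK ex))/addIr.
    by right.
  have xPK : x \in P :\: K by rewrite inE xK.
  rewrite (cent_pair_out xPK ex) => /nontrivial_homology_refl/eqP.
  by rewrite subr_eq addNr => /eqP; left.
case=> ->; last first.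
  exists x0; split=> //; first exact: (subsetP sKP).
  rewrite (cent_pair_in x0K ex0).
  exact/(nontrivial_homology_special _ (special_cent_pair SK eK x0K ex0)).
(* If g outside K commutes with e, multiplying it by an element of K that does not commute with e
   helps. *)
have [x xPK ex] : exists2 x, x \in P :\: K & [~ e, x] != 1.
  have [/commgP eg|eg] := boolP ([~ e, g] == 1); last by exists g; rewrite // inE gK.
  exists (g * x0); first by rewrite inE groupMr // gK groupM // (subsetP sKP).
  rewrite commgMJ; have /eqP-> : [~ e, g] == 1 by apply/commgP.
  by rewrite conj1g mulg1.
exists x; split=> //; first by case/setDP: xPK.
rewrite (cent_pair_out xPK ex) sub0r.
exact/nontrivial_homology_refl.
Qed.

End MaximalClassHomology.

(** * A regular unipotent symplectic matrix *)

Section CayleyTransform.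
Local Open Scope ring_scope.
Variables (F : fieldType) (n' : nat).
Hypotheses (char2 : 2%:R != 0 :> F) (odd_n' : odd n').
Local Notation n := n'.+1.

Definition shift_mx : 'M[F]_n := \matrix_(i, j) (j == i.+1 :> nat)%:R.

Definition alternating_form : 'M[F]_n :=
  \matrix_(i, j) ((-1) ^+ i * (j == rev_ord i)%:R).

Local Notation N := shift_mx.
Local Notation J := alternating_form.

Lemma shift_mx_exp k : N ^+ k = \matrix_(i, j) (j == i + k :> nat)%N%:R.
Proof.
elim: k => [|k IH].
  by apply/matrixP => i j; rewrite !mxE addn0 eq_sym.
apply/matrixP => i j; rewrite exprS IH !mxE.
have [lt_in|ge_in] := ltnP i.+1 n.
  rewrite (bigD1 (Ordinal lt_in)) //= !mxE eqxx mul1r addSnnS big1 ?addr0 // => l.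
  by rewrite -val_eqE /= => li; rewrite !mxE (negbTE li) mul0r.
rewrite big1 => [|l _]; last first.
  by rewrite !mxE [_ == _](ltn_eqF (leq_trans (ltn_ord l) ge_in)) mul0r.
by rewrite (ltn_eqF (leq_trans (ltn_ord j) (leq_trans ge_in _))) // addnS ltnS leq_addr.
Qed.

Lemma shift_mx_nilpotent : N ^+ n = 0.
Proof.
apply/matrixP => i j; rewrite shift_mx_exp !mxE.
by rewrite (ltn_eqF (leq_trans (ltn_ord j) (leq_addl _ _))).
Qed.

Lemma shift_mx_ker (b : 'cV[F]_n) : N *m b = 0 -> b = b 0 0 *: delta_mx 0 0.
Proof.
move=> Nb; apply/matrixP => i j; rewrite !mxE ord1 andbT.
have [->|i0] := eqVneq i 0; first by rewrite mulr1.
rewrite mulr0; have ipos : (0 < i)%N by rewrite lt0n.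
have lt_in : (i.-1 < n)%N by apply: leq_ltn_trans (leq_pred i) (ltn_ord i).
move/matrixP/(_ (Ordinal lt_in) 0): Nb; rewrite !mxE (bigD1 i) //= big1 => [|l li].
  by rewrite mxE /= prednK // eqxx mul1r addr0.
by rewrite !mxE /= prednK // val_eqE (negbTE li) mul0r.
Qed.

Lemma shift_mx_delta : N *m (delta_mx 0 0 : 'cV[F]_n) = 0.
Proof.
apply/matrixP => i j; rewrite !mxE big1 // => l _; rewrite !mxE.
by have [->|] := eqVneq l 0; rewrite /= ?mul0r ?mulr0.
Qed.

Lemma odd_rev_ord (i : 'I_n) : odd (rev_ord i) = ~~ odd i.
Proof.
by rewrite /= subSS oddB; [rewrite odd_n'; case: (odd i)|rewrite -ltnS].
Qed.

Lemma sign_rev_ord (i : 'I_n) : (-1) ^+ rev_ord i = - (-1) ^+ i :> F.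
Proof.
rewrite -signr_odd -(signr_odd _ i) odd_rev_ord.
by case: (odd i); rewrite ?expr0 ?expr1 ?opprK.
Qed.

Lemma alternating_form_sqr : J *m J = - 1%:M.
Proof.
apply/matrixP => i j; rewrite !mxE (bigD1 (rev_ord i)) //= big1 => [|l li]; last first.
  by rewrite !mxE (negbTE li) mulr0 mul0r.
rewrite !mxE eqxx mulr1 rev_ordK addr0 mulrA eq_sym sign_rev_ord mulrN -expr2 sqrr_sign.
by rewrite mulN1r.
Qed.

Lemma alternating_formT : J^T = - J.
Proof.
apply/matrixP => i j; rewrite !mxE -mulNr.
have -> : (i == rev_ord j) = (j == rev_ord i) by apply/eqP/eqP => ->; rewrite rev_ordK.
have [->|] := eqVneq j (rev_ord i); last by rewrite !mulr0.
by rewrite sign_rev_ord.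
Qed.

Lemma alternating_form_shift :
  J *m N = \matrix_(i, j) ((-1) ^+ i * (i + j == n :> nat)%N%:R).
Proof.
apply/matrixP => i j; rewrite !mxE (bigD1 (rev_ord i)) //= big1 => [|l li]; last first.
  by rewrite !mxE (negbTE li) mulr0 mul0r.
rewrite !mxE eqxx mulr1 addr0 /= subSS; congr (_ * _%:R); congr (nat_of_bool _).
by rewrite -(eqn_add2l i) addnS subnKC // -ltnS.
Qed.

(** J N is symmetric: its entries live on i + j = n, where the signs of i and j agree because n is
    even. *)
Lemma shift_mx_skew : N^T *m J = - (J *m N).
Proof.
rewrite -[LHS]trmxK trmx_mul trmxK alternating_formT mulNmx alternating_form_shift.
apply/matrixP => i j; rewrite !mxE addnC; congr (- _).
have [ijn|] := eqVneq (i + j)%N n; last by rewrite !mulr0.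
congr (_ * _); rewrite -signr_odd -(signr_odd _ i).
have : odd (i + j) = odd n by rewrite ijn.
by rewrite oddD /= odd_n'; do 2!case: (odd _).
Qed.

(* The Cayley transform turns shift_mx, which lies in the symplectic Lie algebra
   of alternating_form, into an element of the symplectic group. *)
Definition cayley_mx : 'M[F]_n := (1 + N) * (1 - N)^-1.
Local Notation u := cayley_mx.

Lemma unit_1subN : 1 - N \is a GRing.unit.
Proof.
have := subrX1 N n; rewrite shift_mx_nilpotent sub0r => E.
have /mulmx1_unit[] // : (1 - N) *m (\sum_(i < n) N ^+ i) = 1%:M.
by rewrite -opprB mulNmx; apply/eqP; rewrite eqr_oppLR; apply/eqP/esym.
Qed.

Lemma unit_1addN : 1 + N \is a GRing.unit.
Proof.
have := subrX1 (- N) n; rewrite exprNn shift_mx_nilpotent mulr0 sub0r => E.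
have /mulmx1_unit[] // : (1 + N) *m (\sum_(i < n) (- N) ^+ i) = 1%:M.
by rewrite -(opprK (1 + N)) opprD addrC mulNmx; apply/eqP; rewrite eqr_oppLR; apply/eqP/esym.
Qed.

Lemma cayley_mx_unit : u \is a GRing.unit.
Proof. by rewrite unitrMr ?unit_1addN // unitrV unit_1subN. Qed.

(** Moving J across a transpose exchanges 1 + N and 1 - N, and these commute. *)
Lemma cayley_mx_form : u^T *m J *m u = J.
Proof.
have AJ : (1 + N)^T *m J = J *m (1 - N).
  by rewrite linearD /= trmx1 mulmxDl mul1mx shift_mx_skew mulmxBr mulmx1.
have BJ : (1 - N)^T *m J = J *m (1 + N).
  by rewrite linearB /= trmx1 mulmxBl mul1mx shift_mx_skew mulmxDr mulmx1 opprK.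
have comAB : (1 - N) *m (1 + N) = (1 + N) *m (1 - N).
  have cN : GRing.comm (1 - N) N.
    by apply/commr_sym/commrB; [apply: commr1|apply: commr_refl].
  by apply: (commrD (commr1 _) cN).
have BV : (1 - N) *m (1 - N)^-1 = 1%:M by apply: mulrV; apply: unit_1subN.
rewrite /cayley_mx -mulmxE trmx_mul -!mulmxA (mulmxA _^T J) AJ.
rewrite -!mulmxA (mulmxA (1 - N)) comAB -mulmxA BV mulmx1 -BJ mulmxA.
by rewrite -trmx_mul BV trmx1 mul1mx.
Qed.

Lemma comm_shift_inv : GRing.comm N (1 - N)^-1.
Proof. exact: commrV (commrB (commr1 _) (commr_refl N)). Qed.

(** Makes u unipotent and, where 2 is invertible, identifies its fixed vectors with the kernel of
    N. *)
Lemma cayley_mx_sub1 : u - 1 = N * ((1 - N)^-1 *+ 2).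
Proof.
have -> : u - 1 = (1 + N) * (1 - N)^-1 - (1 - N) * (1 - N)^-1.
  by rewrite mulrV ?unit_1subN.
by rewrite -mulrBl opprB addrCA [1 + N]addrC addrK -mulr2n mulrnAl mulrnAr.
Qed.

Lemma cayley_mx_nilpotent : (u - 1) ^+ n = 0.
Proof.
rewrite cayley_mx_sub1 exprMn_comm ?shift_mx_nilpotent ?mul0r //.
by apply/commrMn/comm_shift_inv.
Qed.

Lemma cayley_mx_fix (b : 'cV[F]_n) : u *m b = b <-> N *m b = 0.
Proof.
have E : (u - 1) *m b = 2%:R *: ((1 - N)^-1 *m (N *m b)).
  rewrite scalemxAl scaler_nat cayley_mx_sub1 mulmxA mulmxE; congr (_ *m b).
  exact/commrMn/comm_shift_inv.
split=> [ub|Nb].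
  have /eqP : 2%:R *: ((1 - N)^-1 *m (N *m b)) = 0 by rewrite -E mulmxBl mul1mx ub subrr.
  rewrite scaler_eq0 (negbTE char2) /= => /eqP BNb.
  have BU : (1 - N)^-1 \in unitmx.
    by have := unit_1subN; rewrite -unitrV.
  by apply: (can_inj (mulKmx BU)); rewrite BNb mulmx0.
have -> : u *m b = b + (u - 1) *m b by rewrite mulmxBl mul1mx addrC subrK.
by rewrite E Nb mulmx0 scaler0 addr0.
Qed.

End CayleyTransform.

(** * A matrix group of maximal class *)

Section MaximalClassGroup.
Local Open Scope ring_scope.
Variables (p m : nat).
Hypotheses (pr_p : prime p) (p_gt : (m.*2 + 4 <= p)%N).
Local Notation n := m.*2.+2.
Local Notation F := 'F_p.
Local Notation J := (alternating_form F m.*2.+1).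
Local Notation N := (shift_mx F m.*2.+1).
Local Notation u := (cayley_mx F m.*2.+1).
Local Notation gT := {unit 'M[F]_n.+2}.
Implicit Types (w : {unit 'M[F]_n}) (b : 'cV[F]_n) (c : 'M[F]_1) (x y : gT).

Lemma odd_dim : odd m.*2.+1. Proof. by rewrite /= odd_double. Qed.

Lemma two_neq0 : 2%:R != 0 :> F.
Proof.
rewrite -(dvdn_pcharf (pchar_Fp pr_p)) gtnNdvd // (leq_trans _ p_gt) //.
by rewrite addnC.
Qed.

(* With w ranging over the powers of the Cayley transform these matrices form the
   semidirect product of the Heisenberg group of the alternating form J by a
   regular unipotent symplectic element; being unipotent of size at most p,
   they have exponent p. *)
Definition affine_mx (w : 'M[F]_n) b c : 'M[F]_n.+2 :=
  (block_mx 1%:M (row_mx c (b^T *m J *m w)) 0 (block_mx 1%:M 0 b w)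
     : 'M_(1 + (1 + n))).

Lemma affine_mx_unit w b c : affine_mx (val w) b c \is a GRing.unit.
Proof.
have E : \det (affine_mx (val w) b c) = \det (val w).
  transitivity (\det (1%:M : 'M[F]_1) * \det (block_mx 1%:M 0 b (val w) : 'M_(1 + n))).
    exact: (@det_ublock F 1 (1 + n)).
  by rewrite (@det_lblock F 1 n) !det1 !mul1r.
by rewrite -[_ \is a GRing.unit]/(_ \in unitmx) unitmxE E -unitmxE; exact: (valP w).
Qed.

Definition affine w b c : gT := FinRing.unit _ (affine_mx_unit w b c).

Definition symplectic w := (val w)^T *m J *m val w = J.

(** The row b^T J w of the product has the required form precisely because w preserves J. *)
Lemma affineM w w' b b' c c' : symplectic w ->
  (affine w b c * affine w' b' c')%g =
  affine (w * w')%g (b + val w *m b') (c' + (c + b^T *m J *m val w *m b')).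
Proof.
move=> Sw; apply: val_inj; rewrite /= /affine_mx -mulmxE.
apply: etrans (@mulmx_block _ 1 (1 + n) 1 (1 + n) 1 (1 + n) _ _ _ _ _ _ _ _) _.
rewrite !mulmx0 !mul0mx !mul1mx !add0r addr0.
rewrite (@mulmx_block _ 1 n 1 n 1 n) (@mul_row_block _ 1 1 n 1 n).
rewrite !mulmx0 !mul0mx !mulmx1 ?mul1mx ?add0r ?addr0.
rewrite (@add_row_mx _ 1 1 n).
congr (block_mx _ (row_mx _ _) _ _).
rewrite linearD /= trmx_mul !mulmxDl addrC; congr (_ + _); first by rewrite !mulmxA.
by rewrite -{1}Sw !mulmxA.
Qed.

Lemma affine_inj w w' b b' c c' :
  affine w b c = affine w' b' c' -> [/\ w = w', b = b' & c = c'].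
Proof.
move/(congr1 val)/(@eq_block_mx _ 1 (1 + n) 1 (1 + n)).
case=> _ /eq_row_mx[-> _] _ /(@eq_block_mx _ 1 n 1 n)[_ _ -> ww].
by split=> //; apply: val_inj.
Qed.

Lemma affine1 : affine 1%g 0 0 = 1%g.
Proof.
apply: val_inj; rewrite /= /affine_mx trmx0 !mul0mx row_mx0.
by rewrite -(@scalar_mx_block _ 1 n); exact: esym (@scalar_mx_block _ 1 (1 + n) 1).
Qed.

(** From exponent k + 2 on, every block of the power contains a factor d^k, so the power n + 2
    vanishes, and n + 2 <= p. *)
Lemma affine_mx_nilpotent w b c : (val w - 1) ^+ n = 0 ->
  (affine_mx (val w) b c - 1) ^+ p = 0.
Proof.
set d := val w - 1; set a := b^T *m J *m val w => d0.
pose G (r : 'rV[F]_n) (s : 'M[F]_1) (z : 'cV[F]_n) (v : 'M[F]_n) : 'M[F]_n.+2 :=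
  block_mx 0 (row_mx s r) 0 (block_mx 0 0 z v) : 'M_(1 + (1 + n)).
have E : affine_mx (val w) b c - 1 = G a c b d.
  apply/eqP; rewrite subr_eq; apply/eqP.
  have -> : 1 = block_mx 1%:M (row_mx (0 : 'M_1) (0 : 'rV_n)) 0
                 (block_mx 1%:M 0 0 1%:M : 'M_(1 + n)) :> 'M[F]_(1 + (1 + n)).
    rewrite (@row_mx0 _ 1 1 n) -(@scalar_mx_block _ 1 n).
    exact: (@scalar_mx_block _ 1 (1 + n) 1).
  apply/esym; apply: etrans (@add_block_mx _ 1 (1 + n) 1 (1 + n) _ _ _ _ _ _ _ _) _.
  rewrite (@add_row_mx _ 1 1 n) (@add_block_mx _ 1 n 1 n) !addr0 !add0r.
  by rewrite /d subrK.
have GE k : G a c b d ^+ k.+2 = G (a *m d ^+ k.+1) (a *m d ^+ k *m b) (d ^+ k.+1 *m b) (d ^+ k.+2).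
  have GM r s z v : G a c b d *m G r s z v = G (a *m v) (a *m z) (d *m z) (d *m v).
    apply: etrans (@mulmx_block _ 1 (1 + n) 1 (1 + n) 1 (1 + n) _ _ _ _ _ _ _ _) _.
    rewrite !mulmx0 !mul0mx !addr0 !add0r.
    rewrite (@mulmx_block _ 1 n 1 n 1 n) (@mul_row_block _ 1 1 n 1 n).
    by rewrite !mulmx0 !mul0mx !addr0 !add0r.
  elim: k => [|k IH]; first by rewrite expr2 -mulmxE GM expr1 expr0 mulmx1.
  rewrite exprS IH -mulmxE GM.
  have dS j : d *m d ^+ j = d ^+ j.+1 by rewrite exprS.
  by congr (G _ _ _ _); rewrite ?mulmxA ?dS.
have nil : (affine_mx (val w) b c - 1) ^+ n.+2 = 0.
  have d1 : d ^+ n.+1 = 0 by rewrite exprSr d0 mul0r.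
  have d2 : d ^+ n.+2 = 0 by rewrite exprSr d1 mul0r.
  rewrite E (GE n) d2 d1 d0 !mulmx0 !mul0mx.
  by rewrite /G (@row_mx0 _ 1 1 n) (@block_mx0 _ 1 n 1 n) (@block_mx0 _ 1 (1 + n) 1 (1 + n)).
have le_p : (n.+2 <= p)%N by rewrite (leq_trans _ p_gt) // addnC.
have := exprD (affine_mx (val w) b c - 1) (p - n.+2) n.+2.
by rewrite subnK // nil mulr0.
Qed.

(** In characteristic p, the Frobenius identity gives x^p - 1 = (x - 1)^p. *)
Lemma affine_exp_p w b c : (val w - 1) ^+ n = 0 -> (affine w b c ^+ p = 1)%g.
Proof.
move=> /(@affine_mx_nilpotent w b c) H; apply: val_inj; rewrite FinRing.val_unitX /=.
have chp : p \in [pchar 'M[F]_n.+2] by rewrite pchar_lalg pchar_Fp.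
have := pFrobenius_autB_comm chp (commr1 (affine_mx (val w) b c)).
by rewrite !pFrobenius_autE H expr1n => /esym/eqP; rewrite subr_eq0 => /eqP.
Qed.

Definition cayley_unit : {unit 'M[F]_n} := FinRing.unit _ (cayley_mx_unit F m.*2.+1).
Local Notation U := (<[cayley_unit]>%g).
Local Notation e0 := (delta_mx 0 0 : 'cV[F]_n).

Let le_np : (n <= p)%N.
Proof. by rewrite (leq_trans _ p_gt) // addnC !ltnS; do 2!apply/leqW. Qed.

Lemma cayley_unit_order : #[cayley_unit]%g = p.
Proof.
apply: nt_prime_order => //.
  apply: val_inj; rewrite FinRing.val_unitX /=.
  have chp : p \in [pchar 'M[F]_n] by rewrite pchar_lalg pchar_Fp.
  have := pFrobenius_autB_comm chp (commr1 u).
  have nil : (u - 1) ^+ p = 0.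
    have := exprD (u - 1) (p - n) n.
    by rewrite subnK // cayley_mx_nilpotent mulr0.
  by rewrite !pFrobenius_autE nil expr1n => /esym/eqP; rewrite subr_eq0 => /eqP.
apply/eqP => /(congr1 val)/= u1.
(* The second basis vector is outside the kernel of N, so u does not fix it. *)
pose b : 'cV[F]_n := delta_mx (lift ord0 ord0) 0.
have /cayley_mx_fix/shift_mx_ker : u *m b = b by rewrite u1 mul1mx.
move=> /(_ two_neq0)/matrixP/(_ (lift ord0 ord0) 0); rewrite !mxE !eqxx /= mulr0.
by move/eqP; rewrite oner_eq0.
Qed.

Lemma symplectic_cycle w : w \in U -> symplectic w.
Proof.
case/cycleP => k ->; elim: k => [|k IH].
  by rewrite /symplectic expg0 /= trmx1 mul1mx mulmx1.
have step (A B : 'M[F]_n) : A^T *m J *m A = J -> B^T *m J *m B = J ->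
    (A *m B)^T *m J *m (A *m B) = J.
  move=> JA JB; rewrite trmx_mul -!mulmxA (mulmxA A^T) (mulmxA (A^T *m J)) JA.
  by rewrite mulmxA.
by rewrite /symplectic expgS; apply: step IH; apply: cayley_mx_form odd_dim.
Qed.

Lemma affineM_cycle w w' b b' c c' : w \in U ->
  (affine w b c * affine w' b' c')%g =
  affine (w * w')%g (b + val w *m b') (c' + (c + b^T *m J *m val w *m b')).
Proof. by move=> /symplectic_cycle; apply: affineM. Qed.

Lemma nilpotent_cycle w : w \in U -> (val w - 1) ^+ n = 0.
Proof.
case/cycleP => k ->; rewrite FinRing.val_unitX /= subrX1.
have cu : GRing.comm (u - 1) (\sum_(i < k) u ^+ i).
  apply: commr_sum => i _; apply: commrX.
  by apply/commr_sym/commrB; [apply: commr_refl|apply: commr1].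
by rewrite exprMn_comm // cayley_mx_nilpotent mul0r.
Qed.

Lemma fixed_cycle w b : u *m b = b -> w \in U -> val w *m b = b.
Proof.
move=> ub /cycleP[k ->]; elim: k => [|k IH]; first by rewrite expg0 mul1mx.
by rewrite expgSr FinRing.val_unitM -mulmxE -mulmxA ub.
Qed.

Lemma cycle_cayley w : w \in U -> w != 1%g -> <[w]>%g = U.
Proof.
move=> wU w1; apply/eqP; rewrite eqEcard cycle_subG wU -!orderE cayley_unit_order.
have /eqP wp : (w ^+ p == 1)%g.
  by have := order_dvdG wU; rewrite -orderE cayley_unit_order order_dvdn.
by rewrite (nt_prime_order pr_p wp w1) leqnn.
Qed.

(** The cyclic group of u has prime order, so u is a power of w and fixes what w fixes. *)
Lemma fixed_of_cycle w b : w \in U -> w != 1%g -> val w *m b = b -> N *m b = 0.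
Proof.
move=> wU w1 wb; apply/(cayley_mx_fix two_neq0).
have : cayley_unit \in <[w]>%g.
  by rewrite (cycle_cayley wU w1) cycle_id.
case/cycleP=> k /(congr1 val); rewrite FinRing.val_unitX /= => ->.
elim: k => [|k IH]; first by rewrite mul1mx.
by rewrite exprSr -mulmxE -mulmxA wb.
Qed.

Definition affine_set (W : {set {unit 'M[F]_n}}) : {set gT} :=
  [set affine t.1.1 t.1.2 t.2 | t in setX (setX W setT) setT].

Lemma affine_setP (W : {set {unit 'M[F]_n}}) x :
  reflect (exists w b c, w \in W /\ x = affine w b c) (x \in affine_set W).
Proof.
apply: (iffP imsetP) => [[[[w b] c]]|[w [b [c [wW ->]]]]].
  by rewrite !inE !andbT /= => wW ->; exists w, b, c.
by exists (w, b, c); rewrite // !inE wW.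
Qed.

Lemma affine_set_group (W : {group {unit 'M[F]_n}}) :
  W \subset U -> group_set (affine_set W).
Proof.
move=> /subsetP WU; apply/group_setP; split.
  by apply/affine_setP; exists 1%g, 0, 0; rewrite group1 affine1.
move=> _ _ /affine_setP[w [b [c [wW ->]]]] /affine_setP[w' [b' [c' [wW' ->]]]].
rewrite affineM_cycle ?WU //.
by apply/affine_setP; do 3!eexists; split; last reflexivity; rewrite groupM.
Qed.

Lemma card_affine_set (W : {set {unit 'M[F]_n}}) :
  #|affine_set W| = (#|W| * p ^ n.+1)%N.
Proof.
rewrite card_imset; last first.
  by move=> [[w b] c] [[w' b'] c'] /affine_inj[/= -> -> ->].
by rewrite !cardsX !cardsT !card_mx card_Fp // muln1 expn1 -mulnA -expnSr.
Qed.

Definition maximal_class_group : {group gT} := group (affine_set_group (subxx U)).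
Definition special_subgroup : {group gT} := group (affine_set_group (sub1G U)).

Definition affine_center_set : {set gT} := [set affine 1%g 0 c | c in [set: 'M[F]_1]].

Lemma affine_center_group : group_set affine_center_set.
Proof.
apply/group_setP; split; first by apply/imsetP; exists 0; rewrite ?affine1 // inE.
move=> _ _ /imsetP[c _ ->] /imsetP[c' _ ->].
rewrite affineM_cycle; last exact: group1.
rewrite mulg1 trmx0 !mul0mx mulmx0 !addr0.
by rewrite imset_f // inE.
Qed.
Definition affine_center : {group gT} := group affine_center_group.

Local Notation P := maximal_class_group.
Local Notation K := special_subgroup.
Local Notation Z := affine_center.

Lemma maximal_class_groupP x :
  reflect (exists w b c, w \in U /\ x = affine w b c) (x \in P).
Proof. exact: affine_setP. Qed.

Lemma special_subgroupP x : reflect (exists b c, x = affine 1%g b c) (x \in K).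
Proof.
apply: (iffP (affine_setP _ _)) => [[w [b [c [/set1P-> ->]]]]|[b [c ->]]].
  by exists b, c.
by exists 1%g, b, c; rewrite inE.
Qed.

Lemma affine_centerP x : reflect (exists c, x = affine 1%g 0 c) (x \in Z).
Proof. by apply: (iffP imsetP) => [[c _ ->]|[c ->]]; exists c; rewrite ?inE. Qed.

Lemma affine_special w b c : w \in U -> (affine w b c \in K) = (w == 1%g).
Proof.
move=> wU; apply/special_subgroupP/eqP => [[b' [c' /affine_inj[]]]|->] //.
by exists b, c.
Qed.

Lemma affineM_center w b c d : w \in U ->
  (affine w b c * affine 1%g 0 d)%g = affine w b (d + c).
Proof. by move=> wU; rewrite affineM_cycle // mulg1 !mulmx0 !addr0. Qed.

Lemma centerM_affine w b c d :
  (affine 1%g 0 d * affine w b c)%g = affine w b (c + d).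
Proof.
rewrite affineM_cycle; last exact: group1.
by rewrite mul1g trmx0 mul1mx !mul0mx add0r addr0.
Qed.

Lemma commg_affine x y w b c c' : w \in U -> (x * y)%g = affine w b c ->
  (y * x)%g = affine w b c' -> [~ x, y]%g \in Z.
Proof.
move=> wU xy yx; apply/affine_centerP; exists (c - c').
have -> : [~ x, y]%g = ((y * x)^-1 * (x * y))%g by rewrite commgEl conjgE invMg !mulgA.
rewrite xy yx; have -> : affine w b c = (affine w b c' * affine 1%g 0 (c - c'))%g.
  by rewrite affineM_center // subrK.
exact: mulKg.
Qed.

Lemma card_affine_center : #|Z| = p.
Proof.
rewrite card_imset; last by move=> c c' /affine_inj[].
by rewrite cardsT card_mx card_Fp.
Qed.

Lemma special_sub_maximal_class : K \proper P.
Proof.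
apply/properP; split.
  apply/subsetP => _ /special_subgroupP[b [c ->]]; apply/maximal_class_groupP.
  by exists 1%g, b, c; rewrite group1.
exists (affine cayley_unit 0 0).
  by apply/maximal_class_groupP; exists cayley_unit, 0, 0; rewrite cycle_id.
rewrite affine_special ?cycle_id // -order_eq1 cayley_unit_order.
by rewrite neq_ltn prime_gt1 ?orbT.
Qed.

Lemma central_pair_maximal_class : central_pair p P Z.
Proof.
split=> //; first exact: card_affine_center.
  apply/subsetP => _ /affine_centerP[d ->]; apply/centerP; split.
    by apply/maximal_class_groupP; exists 1%g, 0, d; rewrite group1.
  move=> _ /maximal_class_groupP[w [b [c [wU ->]]]].
  by rewrite /commute centerM_affine affineM_center // addrC.
move=> _ /maximal_class_groupP[w [b [c [wU ->]]]].
exact/affine_exp_p/nilpotent_cycle.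
Qed.

Lemma affine_specialM b b' c c' :
  (affine 1%g b c * affine 1%g b' c')%g = affine 1%g (b + b') (c' + (c + b^T *m J *m b')).
Proof.
rewrite affineM_cycle; last exact: group1.
by rewrite mulg1 mulmx1 mul1mx.
Qed.

Lemma special_pair_special_subgroup : special_pair p Z m.+1 K.
Proof.
have ZK : Z \subset K.
  by apply/subsetP => _ /affine_centerP[c ->]; apply/special_subgroupP; exists 0, c.
split.
- exact: central_pairS central_pair_maximal_class _ ZK (proper_sub special_sub_maximal_class).
- move=> _ _ /special_subgroupP[b [c ->]] /special_subgroupP[b' [c' ->]].
  apply: (commg_affine (group1 _) (affine_specialM _ _ _ _)).
  by rewrite [b + b']addrC; apply: affine_specialM.
- apply/subsetP => _ /centerP[/special_subgroupP[b [c ->]] cb].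
  apply/affine_centerP; exists c; congr affine.
  (* Centrality makes the form symmetric at b, while J is skew; as 2 is invertible, b is in the
     radical, which is zero since J^2 = -1. *)
  have Jb b' : b^T *m J *m b' = - (b^T *m J *m b').
    have /cb : affine 1%g b' 0 \in K by apply/special_subgroupP; exists b', 0.
    rewrite /commute !affine_specialM => /affine_inj[_ _].
    rewrite !add0r => /addrI E.
    have T (A : 'M[F]_1) : A^T = A by apply/matrixP => k l; rewrite mxE !ord1.
    by rewrite {1}E -[LHS]T !trmx_mul trmxK (alternating_formT F odd_dim) mulNmx mulmxN mulmxA.
  have Jb0 b' : b^T *m J *m b' = 0.
    have := Jb b' => /eqP; rewrite -addr_eq0 -mulr2n -scaler_nat scaler_eq0.
    by rewrite (negbTE two_neq0) => /eqP.
  have bJ : b^T *m J = 0.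
    apply/matrixP => k l; rewrite ord1.
    by have := Jb0 (delta_mx l 0); rewrite -colE => /matrixP/(_ 0 0); rewrite !mxE.
  apply: trmx_inj; rewrite trmx0; apply: oppr_inj; rewrite oppr0.
  by rewrite -(mulmx1 b^T) -mulmxN -(alternating_form_sqr F odd_dim) mulmxA bJ mul0mx.
- by rewrite card_affine_set cards1 mul1n doubleS.
Qed.

Lemma maximal_class_cyclic x y : x \in P :\: K -> y \in P ->
  exists j, (x ^+ j * y)%g \in K.
Proof.
case/setDP=> /maximal_class_groupP[w [b [c [wU ->]]]].
rewrite affine_special // => w1 /maximal_class_groupP[w' [b' [c' [wU' ->]]]].
have : w'^-1%g \in <[w]>%g.
  by rewrite (cycle_cayley wU w1) groupV.
case/cycleP=> j wj; exists j.
have [b1 [c1 ->]] : exists b1 c1, (affine w b c ^+ j)%g = affine (w ^+ j)%g b1 c1.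
  elim: j {wj} => [|j [b1 [c1 IH]]]; first by exists 0, 0; rewrite !expg0 affine1.
  rewrite expgS IH (affineM_cycle _ _ _ _ _ wU) -expgS; by do 2!eexists.
rewrite affineM_cycle ?groupX //.
by rewrite -wj mulVg; apply/special_subgroupP; do 2!eexists.
Qed.

Local Notation e := (affine 1%g e0 0).

Lemma axis_in_special : e \in K.
Proof. by apply/special_subgroupP; exists e0, 0. Qed.

Lemma axis_notin_center : e \notin Z.
Proof.
apply/affine_centerP => -[c /affine_inj[_ /matrixP/(_ 0 0)]].
by rewrite !mxE !eqxx => /eqP; rewrite oner_eq0.
Qed.

(** All powers of u fix [e0], which is in the kernel of N; the two products thus differ only in the
    corner entry. *)
Lemma axis_commg : {in P, forall x, [~ e, x]%g \in Z}.
Proof.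
move=> _ /maximal_class_groupP[w [b [c [wU ->]]]].
apply: (@commg_affine _ _ w (e0 + b)) => //.
  rewrite affineM_cycle; last exact: group1.
  by rewrite mul1g mul1mx.
have we0 : val w *m e0 = e0.
  by apply: fixed_cycle wU; apply/(cayley_mx_fix two_neq0); exact: shift_mx_delta.
by rewrite (affineM_cycle _ _ _ _ _ wU) mulg1 we0 [b + e0]addrC; reflexivity.
Qed.

(** Comparing the vector parts of x y and y x shows that w fixes b', so b' is in the kernel of N,
    the line of [e0]. *)
Lemma axis_regular x y : x \in P :\: K -> y \in K -> [~ y, x]%g \in Z ->
  y \in (Z <*> <[e]>)%g.
Proof.
case/setDP=> /maximal_class_groupP[w [b [c [wU ->]]]].
rewrite affine_special // => w1 /special_subgroupP[b' [c' ->]] /affine_centerP[d yxd].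
have Nb : N *m b' = 0.
  apply: (fixed_of_cycle wU w1).
  have := commgC (affine 1%g b' c') (affine w b c).
  rewrite yxd affineM; last exact/symplectic_cycle/group1.
  rewrite (affineM_cycle _ _ _ _ _ wU) mul1g mulg1 (affineM_center _ _ _ wU) mul1mx.
  by case/affine_inj => _ /eqP; rewrite addrC (inj_eq (addrI b)) => /eqP.
have ek k : exists c1, (e ^+ k)%g = affine 1%g (k%:R *: e0) c1.
  elim: k => [|k [c1 IH]]; first by exists 0; rewrite expg0 scale0r affine1.
  by rewrite expgS IH affine_specialM mulrS scalerDl scale1r; eexists.
have [c1 ec1] := ek (val (b' 0 0)).
have -> : affine 1%g b' c' = (e ^+ val (b' 0 0)%R * affine 1%g 0 (c' - c1))%g.
  rewrite ec1 affineM_center ?group1 // subrK (shift_mx_ker Nb) !mxE !eqxx mulr1.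
  by rewrite natr_Zp.
rewrite groupM //; first by rewrite mem_gen // inE mem_cycle orbT.
by rewrite mem_gen // inE; apply/orP; left; apply/affine_centerP; eexists.
Qed.

Lemma nontrivial_homology_maximal_class_group i :
  nontrivial_homology P Z i <-> i = 0 \/ i = m%:Z.
Proof.
apply: (nontrivial_homology_maximal_class central_pair_maximal_class
  special_sub_maximal_class special_pair_special_subgroup maximal_class_cyclic
  axis_in_special axis_notin_center axis_commg axis_regular).
Qed.
End MaximalClassGroup.

(** * Realizing the members of Omega *)

Section InjectiveTransfer.
Variables (aT rT : finGroupType) (P Z : {group aT}) (f : {morphism P >-> rT}).
Hypotheses (injf : 'injm f) (ZP : Z \subset P).

(** Carries groups from different ambient types into a common central product. *)
Lemma nontrivial_homology_injm i :
  nontrivial_homology (f @* P)%G (f @* Z)%G i <-> nontrivial_homology P Z i.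
Proof.
pose F (E : subgroup_poset aT) : subgroup_poset rT := (f @* E)%G.
pose G (E : subgroup_poset rT) : subgroup_poset aT := (f @*^-1 E)%G.
suff A : acyclic (abelian_above P Z) i <-> acyclic (abelian_above (f @* P)%G (f @* Z)%G) i.
  by rewrite /nontrivial_homology; split=> nA /A.
have GK : {in abelian_above (f @* P)%G (f @* Z)%G, cancel G F}.
  by move=> E /abelian_aboveP[_ EP _]; apply/group_inj/morphpreK.
apply: (@acyclic_iso _ _ _ _ F G) => //.
- move=> E /abelian_aboveP[ZE EP cEE]; apply/abelian_aboveP; split.
  + by rewrite injm_proper.
  + exact: morphimS.
  + exact: morphim_abelian.
- move=> E EX; have /abelian_aboveP[ZE EP cEE] := EX.
  have defE : f @* (f @*^-1 E) = E by apply: morphpreK.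
  have sP : f @*^-1 E \subset P by apply: subsetIl.
  apply/abelian_aboveP; split=> //.
    by rewrite -(injm_proper injf) //= defE.
  by rewrite -(injm_abelian injf) //= defE.
- by move=> E /abelian_aboveP[_ EP _]; apply/group_inj/(injmK injf).
- by move=> E E' _ _ EE'; apply: morphimS.
- by move=> E E' _ _ EE'; apply: morphpreS.
Qed.

Lemma central_pair_injm p : central_pair p P Z -> central_pair p (f @* P)%G (f @* Z)%G.
Proof.
case=> pr_p oZ sZ exp_p; split=> //; first by rewrite card_injm.
  by rewrite -injm_center // morphimS.
by move=> _ /morphimP[x _ xP ->]; rewrite -morphX // exp_p // morph1.
Qed.
End InjectiveTransfer.

Definition realizable (p : nat) (I : set nat) :=
  exists (gT : finGroupType) (P Z : {group gT}), central_pair p P Z /\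
    forall i : int, nontrivial_homology P Z i <-> exists2 n : nat, I n & i = n%:Z.

Lemma realizable_ext p (I J : set nat) :
  (forall n, I n <-> J n) -> realizable p I -> realizable p J.
Proof.
move=> IJ [gT [P [Z [PZ nh]]]]; exists gT, P, Z; split=> // i; rewrite nh.
by split=> -[n /IJ]; exists n.
Qed.

(** A central e outside Z leaves no x for the recursion and kills all homology. Thus the subgroups
    to be amalgamated are the full centers. *)
Lemma center_nontrivial_homology (gT : finGroupType) p (P Z : {group gT}) i :
  central_pair p P Z -> nontrivial_homology P Z i -> 'Z(P)%G = Z.
Proof.
move=> PZ nh; have [_ _ sZ _] := PZ; apply/group_inj/eqP.
rewrite eqEsubset sZ andbT; apply/subsetP => e /centerP[eP ec].
apply/negPn/negP => eZ.
have e1 x : x \in P -> [~ e, x] = 1 by move=> xP; apply/eqP/commgP/ec.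
have eC : {in P, forall x, [~ e, x] \in Z} by move=> x /e1->.
have /(nontrivial_homology_central_pair _ PZ eP eZ eC)[x [xP]] := nh.
by rewrite e1 ?eqxx.
Qed.

Lemma realizable_add p (I J : set nat) : realizable p I -> realizable p J ->
  realizable p [set (1 + i + j)%N | i in I & j in J]%classic.
Proof.
move=> [gT1 [P1 [Z1 [PZ1 nh1]]]] [gT2 [P2 [Z2 [PZ2 nh2]]]].
(* An empty I or J makes the sum empty, and the group realizing the empty set serves again; its
   center may be larger than Z. *)
have [[i0 Ii0]|nI] := pselect (exists i, I i); last first.
  exists gT1, P1, Z1; split=> // i; rewrite nh1; split=> -[n].
    by move=> In; case: nI; exists n.
  by case=> k Ik; case: nI; exists k.
have [[j0 Jj0]|nJ] := pselect (exists j, J j); last first.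
  exists gT2, P2, Z2; split=> // i; rewrite nh2; split=> -[n].
    by move=> Jn; case: nJ; exists n.
  by case=> k _ [l Jl]; case: nJ; exists l.
have defZ1 : 'Z(P1)%G = Z1.
  by apply: (center_nontrivial_homology (i := i0%:Z) PZ1); apply/nh1; exists i0.
have defZ2 : 'Z(P2)%G = Z2.
  by apply: (center_nontrivial_homology (i := j0%:Z) PZ2); apply/nh2; exists j0.
have [pr_p oZ1 _ _] := PZ1; have [_ oZ2 _ _] := PZ2.
have isoZ : 'Z(P1) \isog 'Z(P2).
  have c1 : cyclic 'Z(P1) by apply: prime_cyclic; rewrite (congr_group defZ1) oZ1.
  rewrite (isog_cyclic_card _ c1) (congr_group defZ1) (congr_group defZ2).
  have c2 : cyclic Z2 by apply: prime_cyclic; rewrite oZ2.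
  by rewrite c2 oZ1 oZ2 eqxx.
case: (xcprodP isoZ) => gz isogz.
set f1 := cpairg1 isogz; set f2 := cpair1g isogz.
have inj1 : 'injm f1 := injm_cpairg1 isogz.
have inj2 : 'injm f2 := injm_cpair1g isogz.
have sZ1 := central_pair_sub PZ1; have sZ2 := central_pair_sub PZ2.
have eqZ : (f2 @* Z2)%G = (f1 @* Z1)%G.
  apply: group_inj; rewrite /= -defZ1 -defZ2 /= !injm_center //.
  by rewrite (cpair_center_id isogz).
have CP : central_product p (f1 @* Z1)%G (f1 @* P1)%G (f2 @* P2)%G.
  split.
  - exact: (central_pair_injm inj1).
  - by rewrite -eqZ; apply: (central_pair_injm inj2).
  - exact: im_cpair_cent.
  - by rewrite /= -defZ1 injm_center //; apply: setI_im_cpair.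
exists (cprod_by isogz), ((f1 @* P1) <*> (f2 @* P2))%G, (f1 @* Z1)%G.
split=> [|i]; first exact: central_product_pair CP.
rewrite (nontrivial_homology_central_product _ CP); split.
  case=> k [l [/(nontrivial_homology_injm inj1 sZ1)/nh1[a Ia ->]]].
  rewrite -eqZ => /(nontrivial_homology_injm inj2 sZ2)/nh2[b Jb ->] ->.
  exists (1 + a + b)%N; first by exists a => //; exists b.
  by rewrite -addnA addnC !PoszD.
case=> n [a Ia [b Jb <-]] ->; exists a%:Z, b%:Z; split.
- by apply/(nontrivial_homology_injm inj1 sZ1)/nh1; exists a.
- by rewrite -eqZ; apply/(nontrivial_homology_injm inj2 sZ2)/nh2; exists b.
- by rewrite -addnA addnC !PoszD.
Qed.

Lemma realizable_zero_or p d : prime p -> (d.*2 + 4 <= p)%N ->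
  realizable p [set n | n = 0%N \/ n = d]%classic.
Proof.
move=> pr_p p_gt; exists _, (maximal_class_group p d), (affine_center p d).
split=> [|i]; first exact: central_pair_maximal_class.
rewrite (nontrivial_homology_maximal_class_group pr_p p_gt); split.
  by case=> ->; [exists 0%N; first by left|exists d; first by right].
by case=> n [] -> ->; [left|right].
Qed.

Lemma realizable_pair p a d : prime p -> (d.*2 + 4 <= p)%N ->
  realizable p [set n | n = a \/ n = (a + d)%N]%classic.
Proof.
move=> pr_p p_gt; have p4 : (0.*2 + 4 <= p)%N by apply: leq_trans (leq_addl _ _) p_gt.
elim: a => [|a IH]; first exact: realizable_zero_or.
apply: realizable_ext (realizable_add (realizable_zero_or pr_p p4) IH) => n.
split=> [[k k0 [b bE <-]]|nE].
  have -> : k = 0%N by case: k0.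
  by case: bE => ->; [left|right].
exists 0%N; first by left.
by case: nE => ->; [exists a; first by left|exists (a + d)%N; first by right].
Qed.

(** An abelian group strictly larger than Z works, since e then commutes with everything. The matrix
    group with m = 0 only supplies e and exponent p. *)
Lemma realizable0 p : prime p -> (4 <= p)%N -> realizable p classical_sets.set0.
Proof.
move=> pr_p p_gt; have p4 : (0.*2 + 4 <= p)%N by [].
have PZ := central_pair_maximal_class pr_p p4.
set P := maximal_class_group p 0 in PZ; set Z := affine_center p 0 in PZ.
have eP := subsetP (proper_sub (special_sub_maximal_class pr_p p4)) _
             (axis_in_special p 0).
have eZ := axis_notin_center p 0; set e := affine _ _ _ in eP eZ.
have QP : (Z <*> <[e]>)%G \subset P by rewrite join_subG (central_pair_sub PZ) cycle_subG.
have QZ := central_pairS PZ (joing_subl Z <[e]>) QP.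
exists _, (Z <*> <[e]>)%G, Z; split=> // i; split=> [nh|[]] //.
have eQ : e \in (Z <*> <[e]>)%G by rewrite mem_gen // inE cycle_id orbT.
have e1 x : x \in (Z <*> <[e]>)%G -> [~ e, x] = 1.
  move=> xQ; apply/eqP/commgP/commute_sym/cent1P; apply: subsetP x xQ.
  rewrite join_subG cycle_subG; apply/andP; split; last exact/cent1P.
  by apply/subsetP => z zZ; apply/cent1P/(central_pairC PZ).
have eC : {in (Z <*> <[e]>)%G, forall x, [~ e, x] \in Z} by move=> x /e1->.
have /(nontrivial_homology_central_pair _ QZ eQ eZ eC)[x [xQ]] := nh.
by rewrite e1 ?eqxx.
Qed.

(** A singleton is the case d = 0. *)
Lemma card_le2_cases (I : set nat) : (I #<= `I_2)%card ->
  I = classical_sets.set0 \/ exists a d, I = [set n | n = a \/ n = (a + d)%N]%classic.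
Proof.
move=> /pcard_leP/unsquash f.
have [->|/set0P[x Ix]] := eqVneq I classical_sets.set0; first by left.
right.
(* Three distinct elements of I would need three distinct images below 2. *)
have le2 y z : I y -> I z -> x <> y -> x <> z -> y = z.
  move=> Iy Iz xy xz.
  have inj u v : I u -> I v -> f u = f v -> u = v.
    by move=> Iu Iv; apply: inj; apply: mem_set.
  have lt2 u : I u -> (f u < 2)%N by move=> Iu; have := @funS _ _ _ _ f u Iu.
  apply: (inj) => //.
  have := lt2 _ Ix; have := lt2 _ Iy; have := lt2 _ Iz.
  have : f x <> f y by move=> E; exact: xy (inj _ _ Ix Iy E).
  have : f x <> f z by move=> E; exact: xz (inj _ _ Ix Iz E).
  by case: (f x) (f y) (f z) => [|[|?]] [|[|?]] [|[|?]].
have [[y Iy xy]|ny] := pselect (exists2 y, I y & x <> y); last first.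
  exists x, 0%N; apply/seteqP; split=> n /=; rewrite addn0.
    by move=> In; left; apply: contrapT => nx; apply: ny; exists n; auto.
  by case=> ->.
have IE n : I n <-> n = x \/ n = y.
  split=> [In|[] -> //]; have [->|/eqP nx] := eqVneq n x; first by left.
  by right; apply: le2 => //; apply/nesym.
case/nesym/eqP: xy; rewrite neq_ltn => /orP[] lt.
  exists y, (x - y)%N; apply/seteqP; split=> n /=; rewrite (subnKC (ltnW lt)) IE; tauto.
exists x, (y - x)%N; apply/seteqP; split=> n /=; rewrite (subnKC (ltnW lt)) IE; tauto.
Qed.

Lemma realizable_Omega (I : set nat) : Omega I ->
  exists N : nat, forall p, prime p -> (N < p)%N -> realizable p I.
Proof.
elim=> [{}I /card_le2_cases[->|[a [d ->]]]|{}I J _ [N IN] _ [M JM]].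
- by exists 3 => p pr_p lt_p; apply: realizable0.
- by exists (d.*2 + 4)%N => p pr_p lt_p; apply: realizable_pair => //; apply: ltnW.
- exists (maxn N M) => p pr_p; rewrite gtn_max => /andP[Np Mp].
  by apply: realizable_add; [apply: IN|apply: JM].
Qed.

(** Exponent p makes abelian subgroups elementary. Since Z has order p, containing Z properly forces
    order at least p^2, and order at least p^2 keeps EZ strictly above Z. *)
Lemma acyclic_elementary_abelian_ge2 (gT : finGroupType) p (P Z : {group gT}) i :
  central_pair p P Z ->
  acyclic (elementary_abelian_ge2 p P) i <-> acyclic (abelian_above P Z) i.
Proof.
move=> PZ; have [pr_p oZ _ exp_p] := PZ; have ZP := central_pair_sub PZ.
have pP := central_pair_pgroup PZ.
have ge2P (E : {group gT}) : reflect [/\ E \subset P, abelian E & (p ^ 2 <= #|E|)%N]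
    ((E : subgroup_poset gT) \in elementary_abelian_ge2 p P).
  rewrite inE; apply: (iffP andP) => [[/pElemP[EP /(abelemP pr_p)[cEE _]]]|[EP cEE leE]] //.
  split=> //; apply/pElemP; split=> //; apply/(abelemP pr_p); split=> // x xE.
  exact/exp_p/(subsetP EP).
apply: iff_sym.
apply: (@acyclic_retract_ge _ (subgroup_poset gT) _ _ (fun E => (E <*> Z)%G) _ _ _ _ _ i).
- apply/subsetP => E /abelian_aboveP[ZE EP cEE]; apply/ge2P; split=> //.
  have := proper_card ZE; rewrite oZ (card_pgroup (pgroupS EP pP)).
  by rewrite -{1}(expn1 p) (ltn_exp2l _ _ (prime_gt1 pr_p)) (leq_exp2l _ _ (prime_gt1 pr_p)).
- move=> E /ge2P[EP cEE leE]; apply/abelian_aboveP; split.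
  + rewrite properE joing_subr /=; apply/negP => sub.
    have := subset_leq_card (fintype.subset_trans (joing_subl E Z) sub).
    by rewrite oZ leqNgt (leq_trans _ leE) // -{1}(expn1 p) (ltn_exp2l _ _ (prime_gt1 pr_p)).
  + by rewrite join_subG EP.
  + rewrite abelianY cEE (cyclic_abelian (prime_cyclic _)) ?oZ //=.
    by apply/centsP => z zZ x xE; apply: (central_pairC PZ) => //; apply: (subsetP EP).
- by move=> E /abelian_aboveP[ZE _ _]; apply/group_inj/joing_idPl/proper_sub.
- by move=> E E' _ _ EE'; apply: genS; apply: setSU.
- by move=> E _; apply: joing_subl.
Qed.

Local Close Scope group_scope.

Theorem corollary1p8 (I : set nat) (IOmega : Omega I) :
  exists N : int, forall p : nat, prime p -> N < p%:Z ->
    exists (gT : finGroupType) (P : {group gT}),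
      [/\ (p.-group P)%g,
          forall g : gT, g \in P -> (g ^+ p = 1)%g
        & forall i : int,
            (exists h : reduced_homology
                          (order_complex (elementary_abelian_ge2 p P)) i,
               h != 0)
            <-> (exists2 n : nat, I n & i = n%:Z)].
Proof.
have [N realI] := realizable_Omega IOmega; exists N%:Z => p pr_p.
rewrite ltz_nat => /(realI p pr_p)[gT [P [Z [PZ nh]]]]; exists gT, P.
split; first exact: central_pair_pgroup PZ.
  by case: PZ.
move=> i; rewrite -nh acyclicPn /nontrivial_homology.
by split=> nA /(acyclic_elementary_abelian_ge2 i PZ).
Qed.
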